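(* Let $K$ be a number field with ring of integers $R_K$, and let $E$ be an elliptic curve over $K$. Suppose that $T\hookrightarrow E(K)$ (i.e. $E(K)$ contains a subgroup isomorphic to $T$), where $T$ is one of the groups in the table below. If $E$ has additive reduction at a prime $\mathfrak{p}$ of $K$, then the residue characteristic of $\mathfrak{p}$ is a rational prime lying in the set $S$ associated to $T$: \[ \begin{array}{c|cccccccccc} T & C_5 & C_6 & C_7 & C_8 & C_9 & C_{10} & C_{12} & C_2\times C_4 & C_2\times C_6 & C_2\times C_8\\\hline S & \{5\} & \{2,3\} & \{7\} & \{2\} & \{3\} & \{5\} & \{2,3\} & \{2\} & \{2,3\} & \{2\} \end{array} \]
   Context: $C_N$ denotes the cyclic group of order $N$. An elliptic curve $E/K$ has additive reduction at a prime $\mathfrak{p}$ if, for a minimal Weierstrass model of $E$ at $\mathfrak{p}$ with discriminant $\Delta$ and invariant $c_4$, one has $v_{\mathfrak{p}}(\Delta)>0$ and $v_{\mathfrak{p}}(c_4)>0$. *)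

(* Defs.v *)
From HB Require Import structures.
From mathcomp Require Import all_boot all_order all_algebra all_field.
From mathcomp Require Import ring_quotient.
From mathcomp Require Import boolp classical_sets constructive_ereal.
From mathcomp Require Import ring.
Set Implicit Arguments.
Unset Strict Implicit.
Unset Printing Implicit Defensive.
Import Order.TTheory GRing.Theory Num.Theory.
Local Open Scope ring_scope.

Definition algint (K : fieldExtType rat) : {pred K} :=
  fun x => `[< integralOver (intr : int -> K) x >].

Lemma algint_subring (K : fieldExtType rat) : subring_closed (@algint K).
Proof.
split=> [|x y|x y].
- exact/asboolP/integral1.
- by move=> /asboolP xZ /asboolP yZ; exact/asboolP/integral_sub.
- by move=> /asboolP xZ /asboolP yZ; exact/asboolP/integral_mul.
Qed.

HB.instance Definition _ (K : fieldExtType rat) :=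
  GRing.isSubringClosed.Build K (@algint K) (@algint_subring K).

Record ringOfIntegers (K : fieldExtType rat) := RingOfIntegers {
  algint_val :> K;
  algint_valP : algint_val \in @algint K }.

HB.instance Definition _ (K : fieldExtType rat) :=
  [isSub for @algint_val K].
HB.instance Definition _ (K : fieldExtType rat) :=
  [Choice of ringOfIntegers K by <:].
HB.instance Definition _ (K : fieldExtType rat) :=
  [SubChoice_isSubComNzRing of ringOfIntegers K by <:].

(* [prime_idealr] allows the zero ideal; the primes of [K] are the
   [p : prime_idealr (ringOfIntegers K)] that are also nonzero, with residue
   field [{ideal_quot p}]. *)
Definition nonzero_ideal (R : nzRingType) (I : {pred R}) : Prop :=
  exists2 a : R, a \in I & a != 0.

(* The coefficients [c i] make the zeroth power the whole ring. *)
Definition ideal_pow (R : comNzRingType) (I : {pred R}) (n : nat) (x : R)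
    : Prop :=
  exists (m : nat) (c : 'I_m -> R) (F : 'I_m -> 'I_n -> R),
    (forall i j, F i j \in I) /\ x = \sum_i c i * \prod_j F i j.

Section Valuation.
Variables (K : fieldExtType rat) (p : prime_idealr (ringOfIntegers K)).

(* For [a != 0] the set below is a singleton when [p] is nonzero; the default
   value is then never used. *)
Definition ordp (a : ringOfIntegers K) : nat :=
  xget 0%N [set n | ideal_pow p n a /\ ~ ideal_pow p n.+1 a]%classic.

(* Since [K] is the fraction field of its ring of integers and [ordp] is
   additive on nonzero elements, the set below is a singleton. *)
Definition valp (x : K) : \bar int :=
  if x == 0 then +oo%E else
  (xget 0 [set k : int | exists a b : ringOfIntegers K,
     [/\ a != 0, b != 0, x = algint_val a / algint_val b
       & k = (ordp a)%:Z - (ordp b)%:Z]]%classic)%:E.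

End Valuation.

(* y^2 + a1 x y + a3 y = x^3 + a2 x^2 + a4 x + a6 *)
Record weierstrass (K : fieldType) := Weierstrass {
  wa1 : K; wa2 : K; wa3 : K; wa4 : K; wa6 : K }.

Section Invariants.
Variables (K : fieldType) (W : weierstrass K).

Definition wb2 : K := wa1 W ^+ 2 + 4 * wa2 W.
Definition wb4 : K := 2 * wa4 W + wa1 W * wa3 W.
Definition wb6 : K := wa3 W ^+ 2 + 4 * wa6 W.
Definition wb8 : K :=
  wa1 W ^+ 2 * wa6 W + 4 * wa2 W * wa6 W - wa1 W * wa3 W * wa4 W
  + wa2 W * wa3 W ^+ 2 - wa4 W ^+ 2.
Definition wc4 : K := wb2 ^+ 2 - 24 * wb4.
Definition wdisc : K :=
  - wb2 ^+ 2 * wb8 - 8 * wb4 ^+ 3 - 27 * wb6 ^+ 2 + 9 * wb2 * wb4 * wb6.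

End Invariants.

Record ellipticCurve (K : fieldType) := EllipticCurve {
  ec_weierstrass :> weierstrass K;
  ec_disc_neq0 : wdisc ec_weierstrass != 0 }.

Section Points.
Variables (K : fieldType) (W : weierstrass K).

(* [None] is the point at infinity. *)
Definition on_curve (P : option (K * K)) : bool :=
  if P is Some (x, y) then
    y ^+ 2 + wa1 W * x * y + wa3 W * y
      == x ^+ 3 + wa2 W * x ^+ 2 + wa4 W * x + wa6 W
  else true.

Definition add_raw (P Q : option (K * K)) : option (K * K) :=
  match P, Q with
  | None, _ => Q
  | _, None => P
  | Some (x1, y1), Some (x2, y2) =>
    if (x1 == x2) && (y1 + y2 + wa1 W * x2 + wa3 W == 0) then None else
    let l := if x1 != x2 then (y2 - y1) / (x2 - x1)
             else (3 * x1 ^+ 2 + 2 * wa2 W * x1 + wa4 W - wa1 W * y1)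
                    / (2 * y1 + wa1 W * x1 + wa3 W) in
    let x3 := l ^+ 2 + wa1 W * l - wa2 W - x1 - x2 in
    Some (x3, - (l + wa1 W) * x3 - (y1 - l * x1) - wa3 W)
  end.

Lemma on_curve_add (P Q : option (K * K)) :
  on_curve P -> on_curve Q -> on_curve (add_raw P Q).
Proof.
case: P => [[x1 y1]|] //; case: Q => [[x2 y2]|] // /eqP hP /eqP hQ /=.
case: ifPn => //= hN; apply/eqP.
have e6 : wa6 W = y1 ^+ 2 + wa1 W * x1 * y1 + wa3 W * y1
                  - (x1 ^+ 3 + wa2 W * x1 ^+ 2 + wa4 W * x1).
  by rewrite hP; ring.
have [exx|ne] := eqVneq x1 x2; rewrite /=.
  subst x2; rewrite eqxx /= in hN.
  have eyy : y2 = y1.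
    have : (y2 - y1) * (y1 + y2 + wa1 W * x1 + wa3 W) = 0.
      transitivity ((y2 ^+ 2 + wa1 W * x1 * y2 + wa3 W * y2)
                    - (y1 ^+ 2 + wa1 W * x1 * y1 + wa3 W * y1)); first by ring.
      by rewrite hP hQ subrr.
    by move/eqP; rewrite mulf_eq0 (negPf hN) orbF subr_eq0 => /eqP.
  subst y2.
  have D0 : 2 * y1 + wa1 W * x1 + wa3 W != 0.
    by move: hN; congr (_ != 0); ring.
  set l := _ / _.
  have e4 : wa4 W = l * (2 * y1 + wa1 W * x1 + wa3 W)
                    - 3 * x1 ^+ 2 - 2 * wa2 W * x1 + wa1 W * y1.
    by rewrite /l divfK //; ring.
  by clearbody l; rewrite e6 e4; ring.
have d0 : x2 - x1 != 0 by rewrite subr_eq0 eq_sym.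
set l := _ / _.
have ey : y2 = y1 + l * (x2 - x1) by rewrite /l divfK // addrC subrK.
have e4 : wa4 W = l * (y1 + y2) + wa1 W * y1 + wa1 W * x2 * l + wa3 W * l
  - (x1 ^+ 2 + x1 * x2 + x2 ^+ 2) - wa2 W * (x1 + x2).
  apply: (mulfI d0); apply/eqP; rewrite -subr_eq0; apply/eqP.
  transitivity (x2 ^+ 3 + wa2 W * x2 ^+ 2 + wa4 W * x2 + wa6 W
    - (y2 ^+ 2 + wa1 W * x2 * y2 + wa3 W * y2)).
    by rewrite e6 ey; ring.
  by rewrite hQ subrr.
by clearbody l; rewrite e6 e4 ey; ring.
Qed.

Record points := Point {
  point_val :> option (K * K);
  point_valP : on_curve point_val }.

Definition add_point (P Q : points) : points :=
  Point (on_curve_add (point_valP P) (point_valP Q)).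

End Points.

HB.instance Definition _ (K : fieldType) (W : weierstrass K) :=
  [isSub for @point_val K W].
HB.instance Definition _ (K : fieldType) (W : weierstrass K) :=
  [Choice of points W by <:].

Definition embeds (K : fieldType) (T : zmodType) (E : ellipticCurve K)
    : Prop :=
  exists2 f : T -> points E,
    injective f & {morph f : s t / s + t >-> add_point s t}.

(* The model obtained by the substitution
   x = u^2 x' + r, y = u^3 y' + s u^2 x' + t. *)
Definition change_vars (K : fieldType) (W : weierstrass K) (u r s t : K)
    : weierstrass K :=
  {| wa1 := (wa1 W + 2 * s) / u;
     wa2 := (wa2 W - s * wa1 W + 3 * r - s ^+ 2) / u ^+ 2;
     wa3 := (wa3 W + r * wa1 W + 2 * t) / u ^+ 3;
     wa4 := (wa4 W - s * wa3 W + 2 * r * wa2 W - (t + r * s) * wa1 W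
             + 3 * r ^+ 2 - 2 * s * t) / u ^+ 4;
     wa6 := (wa6 W + r * wa4 W + r ^+ 2 * wa2 W + r ^+ 3 - t * wa3 W
             - t ^+ 2 - r * t * wa1 W) / u ^+ 6 |}.

Definition model_of (K : fieldType) (W W' : weierstrass K) : Prop :=
  exists u r s t : K, u != 0 /\ W' = change_vars W u r s t.

Section Reduction.
Variables (K : fieldExtType rat) (p : prime_idealr (ringOfIntegers K)).

Definition integral_at (W : weierstrass K) : Prop :=
  [/\ (0 <= valp p (wa1 W))%E, (0 <= valp p (wa2 W))%E,
      (0 <= valp p (wa3 W))%E, (0 <= valp p (wa4 W))%E
    & (0 <= valp p (wa6 W))%E].

Definition minimal_model_at (E W : weierstrass K) : Prop :=
  [/\ model_of E W, integral_at W
    & forall W', model_of E W' -> integral_at W' ->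
        (valp p (wdisc W) <= valp p (wdisc W'))%E].

Definition additive_reduction_at (E : ellipticCurve K) : Prop :=
  exists W : weierstrass K,
    [/\ minimal_model_at E W, (0 < valp p (wdisc W))%E
      & (0 < valp p (wc4 W))%E].

End Reduction.

Inductive torsion_table : zmodType -> seq nat -> Prop :=
| TorsionC5 : torsion_table 'Z_5 [:: 5%N]
| TorsionC6 : torsion_table 'Z_6 [:: 2%N; 3%N]
| TorsionC7 : torsion_table 'Z_7 [:: 7%N]
| TorsionC8 : torsion_table 'Z_8 [:: 2%N]
| TorsionC9 : torsion_table 'Z_9 [:: 3%N]
| TorsionC10 : torsion_table 'Z_10 [:: 5%N]
| TorsionC12 : torsion_table 'Z_12 [:: 2%N; 3%N]
| TorsionC2C4 : torsion_table ('Z_2 * 'Z_4)%type [:: 2%N]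
| TorsionC2C6 : torsion_table ('Z_2 * 'Z_6)%type [:: 2%N; 3%N]
| TorsionC2C8 : torsion_table ('Z_2 * 'Z_8)%type [:: 2%N].

(* Main.v *)
(* Put [E] in Tate normal form with respect to a point of [T] of order at
   least 4. The order of the point (and, for C_2 x C_4, the second 2-torsion
   point) makes the two coefficients [b], [c] rational functions of a single
   parameter [t = y / x], where [x], [y] can be taken integral at [p] and not
   both in [p]. Clearing denominators gives an integral model whose discriminant
   and c4 are binary forms in [x], [y]; their resultant is, up to sign, a product
   of primes of [S], and a Bezout identity shows that they cannot both vanish
   modulo [p] unless [p] divides such a prime. But if the reduction is additive,
   then both vanish modulo [p] for every integral model.

   That argument needs [valp p] to be the valuation of a discrete valuation
   ring: the localization of the ring of integers at [p] is a valuation ring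
   because it is integrally closed and every element of [K] is a root of a
   primitive integer polynomial, and it is discrete because a long chain of
   elements of increasing valuation between 0 and [v(l)] would be linearly
   independent over the rationals. *)
From HB Require Import structures.
Require Import Defs.
From mathcomp Require Import all_boot all_order all_algebra all_field.
From mathcomp Require Import ring_quotient.
From mathcomp Require Import boolp classical_sets constructive_ereal.
From mathcomp Require Import ring zify.
Import Order.TTheory GRing.Theory Num.Theory.
Local Open Scope ring_scope.
Set Implicit Arguments.
Unset Strict Implicit.

HB.instance Definition _ (K : fieldExtType rat) :=
  Algebra.isZmodMorphism.Build (ringOfIntegers K) K (@algint_val K)
    (raddfB (\val : {rmorphism ringOfIntegers K -> K})).
HB.instance Definition _ (K : fieldExtType rat) :=
  GRing.isMonoidMorphism.Build (ringOfIntegers K) K (@algint_val K)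
    (rmorph1 (\val : {rmorphism ringOfIntegers K -> K}),
     rmorphM (\val : {rmorphism ringOfIntegers K -> K})).

(** * Integral relations in a number field *)

Section NumberField.
Variable K : fieldExtType rat.
Local Notation O := (ringOfIntegers K).

Lemma intr_alg (c : int) : c%:~R = (c%:~R : rat)%:A :> K.
Proof. by rewrite -(rmorph_int (in_alg K)). Qed.

Lemma intr_eq0_numfield (c : int) : (c%:~R == 0 :> K) = (c == 0).
Proof. by rewrite intr_alg scaler_eq0 oner_eq0 orbF intr_eq0. Qed.

(** More than [\dim {:K}] elements are linearly dependent over the rationals; denominators and the
    content are cleared. The coefficients form a polynomial so that [zcontents] expresses their
    coprimality. *)
Lemma primitive_relation m (x : 'I_m -> K) : (\dim {:K} < m)%N ->
  exists q : {poly int}, [/\ zcontents q = 1, (size q <= m)%N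
    & \sum_(i < m) (q`_i)%:~R * x i = 0].
Proof.
move=> ltm; pose X := [tuple x i | i < m].
have /freeP nfX : ~~ free X.
  apply: contraL ltm => /eqnP; rewrite size_tuple => <-.
  by rewrite -leqNgt dimvS // subvf.
have /existsNP[k] := nfX.
move/not_implyP => [k0 /existsNP[i0 /eqP ki0]].
have [q [a a0 Eq]] := rat_poly_scale (\poly_(i < m) (if insub i is Some j then k j else 0)).
have kE (i : 'I_m) : k i = a%:~R^-1 * (q`_i)%:~R.
  have := congr1 (fun r : {poly rat} => r`_i) Eq.
  by rewrite coef_poly ltn_ord valK coefZ coef_map.
have aQ : a%:~R^-1 != 0 :> rat by rewrite invr_eq0 intr_eq0.
have q0 : q != 0.
  by apply: contraNneq ki0 => q0; rewrite kE q0 coef0 mulr0.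
have szq : (size q <= m)%N.
  rewrite -(size_map_poly_id0 (f := intr : int -> rat)); last first.
    by rewrite intr_eq0 lead_coef_eq0.
  have -> : map_poly intr q = a%:~R *: (\poly_(i < m) (if insub i is Some j then k j else 0)).
    by rewrite Eq scalerA mulfV ?intr_eq0 // scale1r.
  by rewrite size_scale ?intr_eq0 // size_poly.
exists (zprimitive q); split.
- by rewrite zcontents_primitive q0.
- by rewrite size_zprimitive.
have z0 : ((zcontents q)%:~R : rat) != 0 by rewrite intr_eq0 zcontents_eq0.
apply: (scalerI (mulf_neq0 aQ z0)); rewrite scaler0 -[RHS]k0 scaler_sumr.
have qE j : q`_j = zcontents q * (zprimitive q)`_j.
  by rewrite {1}[q]zpolyEprim coefZ.
apply: eq_bigr => i _; rewrite -tnth_nth tnth_mktuple kE qE intrM mulrA.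
by rewrite intr_alg mulr_algl !scalerA.
Qed.

Lemma primitive_annihilator (u : K) : exists q : {poly int},
  zcontents q = 1 /\ (map_poly intr q).[u] = 0.
Proof.
have [q [q1 szq rel]] := @primitive_relation _ (fun i : 'I_(\dim {:K}).+1 => u ^+ i) (ltnSn _).
exists q; split=> //; rewrite -[RHS]rel (horner_coef_wide (n := (\dim {:K}).+1)).
  by apply: eq_bigr => i _; rewrite coef_map.
exact: leq_trans (size_poly _ _) szq.
Qed.

(** Multiplying [a u^n + ... = 0] by [a^(n-1)] gives a monic equation for [a u]. The Horner fold,
    leading coefficient first, lets induction absorb one coefficient at a time. *)
Lemma integral_leading (a u : K) (l : seq K) : a \in @algint K ->
  all [in @algint K] l -> foldl (fun A c => A * u + c) a l = 0 ->
  a * u \in @algint K.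
Proof.
have [-> *|a0] := eqVneq a 0; first by rewrite mul0r rpred0.
move=> aZ.
(* Multiplying by powers of [a] turns the Horner scheme at [u] into a monic
   one at [a * u]. *)
suff gen (A : K) (G : {poly K}) k : G \is monic -> G \is a polyOver (@algint K) ->
    a ^+ k * A = a * G.[a * u] -> all [in @algint K] l ->
    foldl (fun A c => A * u + c) A l = 0 -> a * u \in @algint K.
  move=> lZ; apply: (gen a 1 0%N) => //; rewrite ?monic1 ?rpred1 //.
  by rewrite expr0 mul1r hornerC mulr1.
elim: l A G k => [|c l IHl] A G k /= monG GZ eqA.
  move=> _ A0; apply/asboolP; apply: (integral_root_monic (p := G)) => //.
    by move/eqP: eqA; rewrite A0 mulr0 eq_sym mulf_eq0 (negPf a0).
  by move=> z /(nthP 0)[i _ <-]; apply/asboolP/(polyOverP GZ).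
move=> /andP[cZ lZ]; apply: (IHl _ (G * 'X + (a ^+ k * c)%:P) k.+1) => //.
- rewrite monicE lead_coefDl ?lead_coefMX ?(monicP monG) //.
  by rewrite size_mulX ?monic_neq0 // (leq_ltn_trans (size_polyC_leq1 _)) // ltnS size_poly_gt0 monic_neq0.
- by rewrite rpredD ?rpredM ?polyOverX ?polyOverC // rpredM // rpredX.
- transitivity (a ^+ k * A * (a * u) + a * (a ^+ k * c)).
    by rewrite exprS; ring.
  by rewrite eqA hornerD hornerMX hornerC; ring.
Qed.

End NumberField.

(** * Localization at a prime ideal *)

Section Localization.
Variables (K : fieldExtType rat) (p : prime_idealr (ringOfIntegers K)).
Local Notation O := (ringOfIntegers K).
Local Notation val := (@algint_val K).

(** The localization at [p] inside [K], with fractions cross-multiplied; [in_max] is its maximal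
    ideal. *)
Definition in_local (x : K) : Prop :=
  exists a s : O, s \notin p /\ val a = x * val s.

Definition in_max (x : K) : Prop :=
  exists a s : O, [/\ a \in p, s \notin p & val a = x * val s].

Lemma algint_inj : injective val.
Proof. exact: val_inj. Qed.

Lemma algint_val_eq0 (a : O) : (val a == 0) = (a == 0).
Proof. by rewrite -(inj_eq algint_inj) rmorph0. Qed.

Lemma notin_prime_neq0 (s : O) : s \notin p -> val s != 0.
Proof. by move=> sp; rewrite algint_val_eq0; apply: contraNneq sp => ->; rewrite idealr0. Qed.

Lemma notin_primeM (s t : O) : s \notin p -> t \notin p -> s * t \notin p.
Proof. by move=> sp tp; rewrite prime_idealrM negb_or sp. Qed.

Lemma in_local_val (a : O) : in_local (val a).
Proof. by exists a, 1; rewrite idealr1 rmorph1 mulr1. Qed.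

Lemma in_local_algint x : x \in @algint K -> in_local x.
Proof. by move=> xZ; apply: (in_local_val (RingOfIntegers xZ)). Qed.

Lemma in_local1 : in_local 1.
Proof. by rewrite -(rmorph1 val); apply: in_local_val. Qed.

Lemma in_localM x y : in_local x -> in_local y -> in_local (x * y).
Proof.
move=> [a [s [sp ea]]] [b [t [tp eb]]]; exists (a * b), (s * t).
by rewrite notin_primeM // !rmorphM /= ea eb; split=> //; ring.
Qed.

Lemma in_localX x n : in_local x -> in_local (x ^+ n).
Proof.
move=> xl; elim: n => [|n IHn]; first exact: in_local1.
by rewrite exprS; apply: in_localM.
Qed.

Lemma in_localD x y : in_local x -> in_local y -> in_local (x + y).
Proof.
move=> [a [s [sp ea]]] [b [t [tp eb]]]; exists (a * t + b * s), (s * t).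
by rewrite notin_primeM // rmorphD !rmorphM /= ea eb; split=> //; ring.
Qed.

Lemma in_localN x : in_local x -> in_local (- x).
Proof.
by move=> [a [s [sp ea]]]; exists (- a), s; rewrite rmorphN /= ea mulNr.
Qed.

Lemma in_local_int (c : int) : in_local c%:~R.
Proof. by rewrite -(rmorph_int val); apply: in_local_val. Qed.

Lemma in_max_local x : in_max x -> in_local x.
Proof. by move=> [a [s [_ sp ea]]]; exists a, s. Qed.

Lemma in_max_val (a : O) : in_max (val a) <-> a \in p.
Proof.
split=> [[b [s [bp sp /eqP]]]|ap]; last by exists a, 1; rewrite idealr1 rmorph1 mulr1.
rewrite -rmorphM (inj_eq algint_inj) => /eqP ebs.
by move: bp; rewrite ebs prime_idealrM (negPf sp) orbF.
Qed.

Lemma in_max0 : in_max 0.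
Proof. by rewrite -(rmorph0 val); apply/in_max_val/idealr0. Qed.

Lemma in_max1 : ~ in_max 1.
Proof. by rewrite -(rmorph1 val) => /in_max_val; rewrite idealr1. Qed.

Lemma in_maxMl x y : in_local x -> in_max y -> in_max (x * y).
Proof.
move=> [a [s [sp ea]]] [b [t [bp tp eb]]]; exists (a * b), (s * t).
by rewrite notin_primeM // idealMr // !rmorphM /= ea eb; split=> //; ring.
Qed.

Lemma in_maxMr x y : in_max x -> in_local y -> in_max (x * y).
Proof. by rewrite mulrC => xm yl; apply: in_maxMl. Qed.

Lemma in_maxD x y : in_max x -> in_max y -> in_max (x + y).
Proof.
move=> [a [s [ap sp ea]]] [b [t [bp tp eb]]]; exists (t * a + s * b), (s * t).
rewrite notin_primeM // rpredD ?idealMr // rmorphD !rmorphM /= ea eb.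
by split=> //; ring.
Qed.

Lemma in_maxN x : in_max x -> in_max (- x).
Proof. by rewrite -mulN1r => /in_maxMl; apply; apply/in_localN/in_local1. Qed.

Lemma in_max_sum (I : Type) (r : seq I) (P : pred I) (F : I -> K) :
  (forall i, P i -> in_max (F i)) -> in_max (\sum_(i <- r | P i) F i).
Proof. by move=> FP; apply: big_ind => //; [apply: in_max0|apply: in_maxD]. Qed.

Lemma in_local_inv x : in_local x -> ~ in_max x -> in_local x^-1.
Proof.
move=> [a [s [sp ea]]] nx.
have ap : a \notin p by apply/negP => ap; apply: nx; exists a, s.
exists s, a; split=> //; rewrite ea mulrA mulVf ?mul1r //.
by have := notin_prime_neq0 ap; apply: contraNneq => x0; rewrite ea x0 mul0r.
Qed.

Lemma in_maxM x y : in_local x -> in_local y -> in_max (x * y) ->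
  in_max x \/ in_max y.
Proof.
move=> [a [s [sp ea]]] [b [t [tp eb]]] [c [r [cp rp ec]]].
have : c * (s * t) \in p by rewrite mulrC idealMr.
have -> : c * (s * t) = a * b * r.
  by apply: algint_inj; rewrite !rmorphM /= ea eb ec; ring.
rewrite !prime_idealrM (negPf rp) orbF => /orP[ap|bp]; [left|right].
  by exists a, s.
by exists b, t.
Qed.

Lemma in_maxX x n : in_local x -> in_max (x ^+ n) -> in_max x.
Proof.
move=> xl; elim: n => [/in_max1//|n IHn]; rewrite exprS => /in_maxM.
by move=> /(_ xl (in_localX n xl))[].
Qed.

(** * Primes above a rational prime [l] *)

Section Residue.
Variable l : nat.
Hypotheses (l_pr : prime l) (lp : l%:R \in p).

(** For [c] prime to [l], a Bezout relation between them would put 1 in [p]. *)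
Lemma int_prime_ideal (c : int) : (c%:~R \in p) = (l %| c)%Z.
Proof.
apply/idP/idP => [cp|/dvdzP[d ->]]; last first.
  by rewrite intrM idealMr //.
apply/contraT => ndv.
have : coprimez c l.
  rewrite coprimez_sym /coprimez /gcdz /=.
  by move: ndv; rewrite dvdzE /= -prime_coprime // /coprime => /eqP->.
case/coprimezP=> [[u v]] /= e.
have : (u * c + v * l)%:~R \in p.
  by rewrite intrD !intrM rpredD // idealMr.
by rewrite e idealr1.
Qed.

Lemma in_max_int (c : int) : in_max c%:~R <-> (l %| c)%Z.
Proof. by rewrite -(rmorph_int val) in_max_val int_prime_ideal. Qed.

Lemma zcontents1_ndvd (q : {poly int}) : zcontents q = 1 ->
  exists i, ~~ (l %| q`_i)%Z.
Proof.
move=> q1; apply: contrapT => H.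
have : q \is a polyOver (dvdz l).
  by apply/polyOverP => i; apply/negPn/negP => ni; apply: H; exists i.
rewrite -dvdz_contents q1 dvdzE /= dvdn1 => /eqP l1.
by move: l_pr; rewrite l1.
Qed.

(** A primitive annihilator of [s] has a coefficient prime to [l]. Once the terms below the lowest
    such coefficient are stripped, that coefficient is invertible modulo [p] and yields an inverse
    of [s]. *)
Lemma prime_ideal_maximal (s : O) : s \notin p -> exists u : O, 1 - s * u \in p.
Proof.
move=> sp; have [q [q1 q0]] := primitive_annihilator (val s).
have: (map_poly intr q).[s] \in p.
  suff -> : (map_poly intr q).[s] = 0 by rewrite idealr0.
  apply: algint_inj; rewrite [RHS]rmorph0 -horner_map /= -map_poly_comp -[RHS]q0.
  by congr _.[_]; apply: eq_map_poly => c /=; rewrite rmorph_int.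
have: q \isn't a polyOver (dvdz l).
  have [i ni] := zcontents1_ndvd q1.
  by apply: contra ni => /polyOverP.
elim/poly_ind: q {q1 q0} => [|q c IHq]; first by rewrite rpred0.
rewrite rmorphD rmorphM /= map_polyX map_polyC hornerD hornerMX hornerC /=.
have [cl|cl] := boolP (l %| c)%Z.
  have cp : c%:~R \in p by rewrite int_prime_ideal.
  move=> nq; rewrite rpredDr // prime_idealrM (negPf sp) orbF; apply: IHq.
  apply: contra nq => /polyOverP qP; apply/polyOverP => -[|i].
    by rewrite coefD coefMX coefC /= add0r.
  by rewrite coefD coefMX coefC /= addr0; apply: qP.
move=> _ hp.
have : coprimez c l.
  rewrite coprimez_sym /coprimez /gcdz /=.
  by move: cl; rewrite dvdzE /= -prime_coprime // /coprime => /eqP->.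
case/coprimezP=> [[u v]] /= e.
(* Since [q(s) s = - c] modulo [p] and [u c = 1] modulo [l], this inverts [s]. *)
exists (- ((map_poly intr q).[s] * u%:~R)).
have e1 : u%:~R * c%:~R + v%:~R * l%:R = 1 :> O.
  by rewrite -[l%:R]/((l : int)%:~R) -!intrM -intrD e.
set g := _.[s] in hp *.
have -> : 1 - s * - (g * u%:~R) = u%:~R * (g * s + c%:~R) + v%:~R * l%:R.
  by rewrite -{1}e1; ring.
by rewrite rpredD // idealMr.
Qed.

(* Kaplansky's "u or u^-1" lemma: [O] is integrally closed, and while the
   leading coefficient and its product with [u] both lie in [p], the degree
   of the relation satisfied by [u] can be lowered. *)
Lemma in_local_total (u : K) : in_local u \/ in_local u^-1.
Proof.
have [q [q1 q0]] := primitive_annihilator u.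
suff gen (r : seq K) a : a \in @algint K -> all [in @algint K] r ->
    foldl (fun A c => A * u + c) a r = 0 ->
    ~ (in_max a /\ forall c, c \in r -> in_max c) ->
    in_local u \/ in_local u^-1.
  (* The Horner fold starts from a dummy leading coefficient 0; primitivity keeps some coefficient
     out of the maximal ideal. *)
  apply: (gen (rev (map_poly intr q)) 0); rewrite ?rpred0 //.
  - rewrite all_rev; apply/allP => x /(nthP 0)[i _ <-].
    by rewrite coef_map /= rpred_int.
  - rewrite foldl_rev -[RHS]q0 /horner.
    by elim: (polyseq _) => //= c s ->.
  - move=> [_ H]; have [i ni] := zcontents1_ndvd q1.
    move: (ni); apply/negP/negPn/in_max_int.
    have [lti|lei] := ltnP i (size (map_poly (intr : int -> K) q)).
      by apply: H; rewrite mem_rev -(coef_map intr); apply: mem_nth.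
    by rewrite -(coef_map intr) nth_default //; apply: in_max0.
elim: r a => [|c r IHr] a /= aZ.
  by move=> _ a0 []; split=> //; rewrite a0; apply: in_max0.
move=> /andP[cZ rZ] e0 nall.
have bZ : a * u \in @algint K.
  by apply: (integral_leading (l := c :: r)) => //=; rewrite cZ.
have [am|nam] := pselect (in_max a); last first.
  left; have a0 : a != 0 by apply: contra_notN nam => /eqP->; apply: in_max0.
  rewrite -[u](mulKf a0); apply: in_localM; last exact: in_local_algint.
  by apply: in_local_inv => //; apply: in_local_algint.
have [bm|nbm] := pselect (in_max (a * u)); last first.
  right; have b0 : a * u != 0 by apply: contra_notN nbm => /eqP->; apply: in_max0.
  have -> : u^-1 = a * (a * u)^-1.
    by rewrite invfM mulrA mulfV ?mul1r //; apply: contraNneq b0 => ->; rewrite mul0r.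
  apply: in_localM; first exact: in_local_algint.
  by apply: in_local_inv => //; apply: in_local_algint.
(* Both [a] and [a u] are in the maximal ideal: [a u + c] becomes the leading coefficient, and some
   coefficient still lies outside. *)
apply: (IHr (a * u + c)); rewrite ?rpredD // => -[bcm rm].
apply: nall; split=> // d; rewrite inE => /predU1P[->|]; last exact: rm.
by rewrite -(addKr (a * u) c); apply: in_maxD => //; apply: in_maxN.
Qed.

End Residue.
End Localization.

(** * The valuation of a prime ideal *)

Section Valuation.
Variables (K : fieldExtType rat) (p : prime_idealr (ringOfIntegers K)).
Local Notation O := (ringOfIntegers K).
Local Notation val := (@algint_val K).
Local Notation in_local := (in_local p).
Local Notation in_max := (in_max p).

(** Once factors of the indeterminate are removed from an annihilating polynomial of [a], its
    constant term is nonzero and a multiple of [a]. *)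
Lemma algint_dvd_int (a : O) : a != 0 ->
  exists2 c : int, c != 0 & exists b : O, c%:~R = a * b.
Proof.
move=> a0; have [q [q1 q0]] := primitive_annihilator (val a).
have {q1} qn0 : q != 0 by apply: contra_eq_neq q1 => ->; rewrite zcontents0.
have {q0} : (map_poly intr q).[a] = 0.
  apply: algint_inj; rewrite [RHS]rmorph0 -horner_map /= -map_poly_comp -[RHS]q0.
  by congr _.[_]; apply: eq_map_poly => c /=; rewrite rmorph_int.
elim/poly_ind: q qn0 => [|q c IHq]; first by rewrite eqxx.
rewrite rmorphD rmorphM /= map_polyX map_polyC hornerD hornerMX hornerC /=.
have [-> q0|c0 _ e] := eqVneq c 0; last first.
  exists c => //; exists (- (map_poly intr q).[a]).
  by apply/eqP; rewrite mulrN -addr_eq0 addrC [a * _]mulrC e.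
rewrite rmorph0 addr0 => /(congr1 val) /eqP.
rewrite rmorphM rmorph0 /= mulf_eq0 !algint_val_eq0 (negPf a0) orbF => /eqP.
by apply: IHq; apply: contraNneq q0 => ->; rewrite mul0r add0r.
Qed.

(** A nonzero element of [p] has a nonzero integer multiple; by primality, one of the prime factors
    of this integer is in [p]. *)
Lemma nonzero_ideal_prime : nonzero_ideal p ->
  exists2 l : nat, prime l & l%:R \in p.
Proof.
move=> [a ap a0]; have [c c0 [b cE]] := algint_dvd_int a0.
have cp : c%:~R \in p by rewrite cE mulrC idealMr.
have {cp cE} : `|c|%N%:R \in p.
  suff : `|c|%N%:R = c%:~R :> O \/ `|c|%N%:R = - c%:~R :> O.
    by case=> ->; rewrite ?rpredN.
  rewrite -[_%:R]/(`|c|%N%:~R); have [cge|clt] := leP 0 c.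
    by left; rewrite gez0_abs.
  by right; rewrite ltz0_abs // rmorphN.
have : (0 < `|c|)%N by rewrite absz_gt0.
elim/ltn_ind: `|c|%N => m IHm m0 mp.
have [m1|m1] := leqP m 1.
  by move: mp; rewrite (_ : m = 1%N) ?idealr1 //; apply/eqP; rewrite eqn_leq m1.
have := pdiv_dvd m; move/dvdnP => [d md].
have d0 : (0 < d)%N by move: m0; rewrite {1}md; case: (d).
move: (mp); rewrite md natrM prime_idealrM => /orP[dp|lp]; last first.
  by exists (pdiv m); rewrite ?pdiv_prime.
apply: (IHm d) => //; rewrite [X in (_ < X)%N]md ltn_Pmulr //.
exact/prime_gt1/pdiv_prime.
Qed.

(** * Discreteness of the valuation *)

Variable l : nat.
Hypotheses (l_pr : prime l) (lp : l%:R \in p).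

Lemma natl_neq0 : (l%:R : K) != 0.
Proof.
rewrite -[l%:R]/((l : int)%:~R) intr_eq0_numfield.
by have := prime_gt0 l_pr; case: (l).
Qed.

(* In a relation with coprime integer coefficients, the term of least
   valuation among those whose coefficient is prime to [l] would be alone. *)
Lemma max_chain_bound (x : 'I_(\dim {:K}).+1 -> K) :
  (forall i, [/\ x i != 0, in_max (x i) & in_local (l%:R / x i)]) ->
  (forall i j : 'I_(\dim {:K}).+1, (i < j)%N -> in_max (x i / x j)) -> False.
Proof.
move=> hx chain; have [q [q1 szq rel]] := primitive_relation x (ltnSn _).
pose P (i : 'I_(\dim {:K}).+1) := ~~ (l %| q`_i)%Z.
have [i0 Pi0] : exists i, P i.
  have [i ni] := zcontents1_ndvd l_pr q1.
  have lti : (i < (\dim {:K}).+1)%N.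
    apply: leq_trans szq; rewrite ltnNge; apply: contra ni => /(nth_default 0) ->.
    exact: dvdz0.
  by exists (Ordinal lti).
have [i Pi imax] := @arg_maxnP _ i0 P (fun j => nat_of_ord j) Pi0.
move: (Pi); apply/negP/negPn/(in_max_int l_pr lp).
have [xi0 xim xil] := hx i.
have -> : (q`_i)%:~R = - \sum_(j | j != i) (q`_j)%:~R * (x j / x i).
  apply: (mulIf xi0); rewrite mulNr mulr_suml; apply/eqP; rewrite -addr_eq0.
  apply/eqP; rewrite -[RHS]rel [RHS](bigD1 i) //=; congr (_ + _).
  by apply: eq_bigr => j _; rewrite mulrA divfK.
apply/in_maxN/in_max_sum => j ji; have [xj0 xjm xjl] := hx j.
have [ltji|leij] := ltnP j i.
  by apply: in_maxMl; [apply: in_local_int|apply: chain].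
have lj : (l %| q`_j)%Z.
  apply: contraNT ji => Pj; rewrite -val_eqE eqn_leq leij andbT.
  exact: imax.
have /dvdzP[d ->] := lj; rewrite intrM.
(* Beyond [i] the coefficient supplies a factor [l], and [l / x i] is local. *)
have -> : d%:~R * l%:~R * (x j / x i) = d%:~R * (l%:R / x i) * x j by ring.
by apply: in_maxMl => //; apply: in_localM => //; apply: in_local_int.
Qed.

Lemma not_local_max (x : K) : ~ in_local x -> in_max x^-1.
Proof.
move=> nx; have [//|xVl] := in_local_total l_pr lp x.
by apply: contrapT => /(in_local_inv xVl); rewrite invrK.
Qed.

(** Otherwise every nonzero element of [p] could be replaced by one of strictly smaller valuation,
    and iterating from [l] would contradict [max_chain_bound]. *)
Lemma uniformizer_exists :
  exists t : O, [/\ t \in p, t != 0 & forall z, in_max z -> in_local (z / val t)].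
Proof.
apply: contrapT => nt.
have next (t : O) : exists t' : O, t \in p -> t != 0 ->
    [/\ t' \in p, t' != 0 & in_max (val t / val t')].
  have [tp|] := boolP (t \in p); last by exists 0.
  have [->|t0] := eqVneq t 0; first by exists 0.
  have : ~ forall z, in_max z -> in_local (z / val t).
    by move=> H; apply: nt; exists t.
  move=> /existsNP[z /not_implyP[[a [s [ap sp ea]]] nz]].
  have na : ~ in_local (val a / val t).
    apply: contra_not nz => al.
    have -> : z / val t = (val a / val t) * (val s)^-1.
      by rewrite ea mulrAC mulfK // (notin_prime_neq0 sp).
    apply: in_localM => //; apply: in_local_inv; first exact: in_local_val.
    by move/in_max_val; apply/negP.
  exists a => _ _; split=> //.
    apply: contra_notN na => /eqP->; rewrite rmorph0 mul0r.
    exact/in_max_local/in_max0.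
  by have := not_local_max na; rewrite invf_div.
have [g gP] := choice next.
pose x i := iter i g (l%:R : O).
have xP i : x i \in p /\ x i != 0.
  elim: i => [|i [IHp IH0]]; last by have [] := gP _ IHp IH0.
  by split=> //=; rewrite -algint_val_eq0 rmorph_nat natl_neq0.
have chain i j : (i < j)%N -> in_max (val (x i) / val (x j)).
  elim: j => // j IHj; rewrite ltnS leq_eqVlt => /predU1P[->|/IHj xij].
    by have [xp x0] := xP j; have [] := gP _ xp x0.
  have [xp x0] := xP j; have [_ _ mj] := gP _ xp x0.
  have -> : val (x i) / val (x j.+1)
      = (val (x i) / val (x j)) * (val (x j) / val (x j.+1)).
    by rewrite mulrA divfK ?algint_val_eq0.
  exact/in_maxMr/in_max_local.
apply: (@max_chain_bound (fun i => val (x i))) => [i|i j]; last exact: chain.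
have [xp x0] := xP i; split; rewrite ?algint_val_eq0 //; first exact/in_max_val.
case: i xp x0 => -[|i] lti /= xp x0; last first.
  by have /in_max_local := chain 0%N i.+1 isT; rewrite /x /= rmorph_nat.
by rewrite rmorph_nat divff ?natl_neq0 //; apply: in_local1.
Qed.

(** * Factorization by a uniformizer [t] *)

Variable t : O.
Hypotheses (tp : t \in p) (t0 : t != 0).
Hypothesis t_unif : forall z, in_max z -> in_local (z / val t).
Local Notation pi := (val t).

Lemma pi_neq0 : pi != 0. Proof. by rewrite algint_val_eq0. Qed.
Local Hint Resolve pi_neq0 : core.

Lemma in_max_pi : in_max pi. Proof. exact/in_max_val. Qed.

Definition local_unit (u : K) : Prop := [/\ u != 0, in_local u & in_local u^-1].

Lemma local_unit1 : local_unit 1.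
Proof. by split; rewrite ?invr1 ?oner_eq0 //; apply: in_local1. Qed.

Lemma local_unitM u v : local_unit u -> local_unit v -> local_unit (u * v).
Proof.
move=> [u0 ul uVl] [v0 vl vVl]; split; rewrite ?mulf_neq0 ?invfM //;
  exact: in_localM.
Qed.

Lemma local_unitV u : local_unit u -> local_unit u^-1.
Proof. by move=> [u0 ul uVl]; split; rewrite ?invrK ?invr_eq0. Qed.

Lemma local_unitP u : in_local u -> ~ in_max u -> local_unit u.
Proof.
move=> ul um; split=> //; last exact: in_local_inv.
by apply: contra_notN um => /eqP->; apply: in_max0.
Qed.

Lemma local_unit_notin (s : O) : s \notin p -> local_unit (val s).
Proof.
move=> sp; apply: local_unitP; first exact: in_local_val.
by move/in_max_val; apply/negP.
Qed.

(** If no power of [pi] were a multiple of [l], all of them would divide [l], giving too long a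
    chain. *)
Lemma pi_power_over_natl : exists m, in_local (pi ^+ m / l%:R).
Proof.
apply: contrapT => H.
have Hl m : in_local (l%:R / pi ^+ m).
  have [|//] := in_local_total l_pr lp (pi ^+ m / l%:R); last by rewrite invf_div.
  by move=> Hm; case: H; exists m.
have pim m : in_max (pi ^+ m.+1).
  by rewrite exprS; apply: in_maxMr; [apply: in_max_pi|apply/in_localX/in_local_val].
(* The exponents decrease from [\dim {:K} + 1] to 1: valuations fall along the chain, yet stay
   positive. *)
apply: (@max_chain_bound (fun i => pi ^+ ((\dim {:K}).+1 - i))) => [i|i j ltij].
  by split; rewrite ?expf_neq0 // subSn //; rewrite -ltnS.
rewrite -expfB; last by rewrite ltn_sub2l //; apply: ltn_ord.
have E (d a b : nat) : (a < b)%N -> (b < d)%N -> (d - a - (d - b) = (b - a).-1.+1)%N.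
  by lia.
by rewrite E.
Qed.

(** Factors [l] are removed one at a time; an integer prime to [l] is a unit of the localization. *)
Lemma pi_power_over_int (c : int) : c != 0 -> exists m, in_local (pi ^+ m / c%:~R).
Proof.
have [k] := ubnP `|c|%N; elim: k c => // k IHk c ltck c0.
have [/dvdzP[d cE]|ndv] := boolP (l %| c)%Z; last first.
  exists 0%N; rewrite expr0 div1r; apply: in_local_inv; first exact: in_local_int.
  by move/(in_max_int l_pr lp); apply/negP.
have d0 : d != 0 by apply: contraNneq c0 => d0; rewrite cE d0 mul0r.
have [||m dm] := IHk d => //.
  rewrite -ltnS; apply: leq_trans ltck; rewrite ltnS cE abszM ltn_Pmulr ?absz_gt0 //.
  exact: prime_gt1.
have [n ln] := pi_power_over_natl; exists (m + n)%N.
rewrite cE intrM exprD -mulf_div; exact: in_localM.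
Qed.

(** A nonzero local element divides a nonzero integer in the localization, which reduces to the
    integer case. *)
Lemma pi_power_over (x : K) : in_local x -> x != 0 -> exists m, in_local (pi ^+ m / x).
Proof.
move=> [a [s [sp ea]]] x0; have s0 := notin_prime_neq0 sp.
have a0 : a != 0 by rewrite -algint_val_eq0 ea mulf_neq0.
have [c c0 [b cE]] := algint_dvd_int a0.
have [m cm] := pi_power_over_int c0; exists m.
have cE' : c%:~R = val a * val b by rewrite -rmorphM -cE rmorph_int.
have cn0 : c%:~R != 0 :> K by rewrite intr_eq0_numfield.
have -> : pi ^+ m / x = pi ^+ m / c%:~R * val b * val s.
  apply: (mulIf x0); rewrite divfK // -[LHS](divfK cn0) -!mulrA.
  by congr (_ * (_ * _)); rewrite cE' ea; ring.
by do 2?apply: in_localM => //; apply: in_local_val.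
Qed.

(** An exponent [m] with [pi^m / x] local bounds how often [pi] can be divided out of [x]. *)
Lemma local_factor (x : K) : in_local x -> x != 0 ->
  exists (k : nat) (u : K), local_unit u /\ x = pi ^+ k * u.
Proof.
move=> xl x0; have [m] := pi_power_over xl x0.
elim: m x xl x0 => [|m IHm] x xl x0.
  rewrite expr0 div1r => xV; exists 0%N, x; split; last by rewrite mul1r.
  by split.
move=> xm; have [xmax|] := pselect (in_max x); last first.
  move=> nx; exists 0%N, x; split; last by rewrite mul1r.
  exact: local_unitP.
have [||k [u [uu e]]] := IHm (x / pi) (t_unif xmax); rewrite ?mulf_neq0 ?invr_eq0 //.
  have -> // : pi ^+ m / (x / pi) = pi ^+ m.+1 / x.
  by rewrite invf_div mulrA -exprSr.
by exists k.+1, u; split=> //; rewrite exprS -mulrA -e mulrCA mulfV // mulr1.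
Qed.

Lemma factor (x : K) : x != 0 -> exists (k : int) (u : K),
  local_unit u /\ x = pi ^ k * u.
Proof.
move=> x0; have [xl|xl] := in_local_total l_pr lp x.
  by have [k [u [uu ->]]] := local_factor xl x0; exists k, u.
have [|k [u [uu e]]] := local_factor xl; first by rewrite invr_eq0.
exists (- k%:Z), u^-1; split; first exact: local_unitV.
by rewrite -exprnN -invfM -e invrK.
Qed.

Lemma in_local_factor (k : int) (u : K) : local_unit u ->
  in_local (pi ^ k * u) <-> 0 <= k.
Proof.
move=> [u0 ul uVl]; split=> [|k0]; last first.
  apply: in_localM => //; case: k k0 => // k _.
  exact/in_localX/in_local_val.
case: k => // k; rewrite NegzE => H; exfalso; apply: (@in_max1 _ p).
have -> : 1 = pi * (pi ^+ k * (pi ^ (- (k.+1)%:Z) * u * u^-1)).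
  by rewrite mulfK // mulrA -exprS -exprnN mulfV // expf_neq0.
apply: in_maxMr; first exact: in_max_pi.
apply: in_localM; last exact: in_localM.
exact/in_localX/in_local_val.
Qed.

Lemma in_max_factor (k : int) (u : K) : local_unit u ->
  in_max (pi ^ k * u) <-> 0 < k.
Proof.
move=> uu; split=> [/t_unif|k0].
  have -> : pi ^ k * u / pi = pi ^ (k - 1) * u.
    by rewrite mulrAC expfzDr // exprN1.
  by move/(in_local_factor _ uu); rewrite subr_ge0; lia.
have -> : pi ^ k * u = pi * (pi ^ (k - 1) * u).
  by rewrite mulrA -{2}[pi]expr1z -expfzDr // addrCA subrr addr0.
apply: in_maxMr; first exact: in_max_pi.
by apply/(in_local_factor _ uu); rewrite subr_ge0; lia.
Qed.

(** Ideal powers are formed in the ring of integers; maximality of [p] lets membership descend from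
    the localization. *)
Lemma ideal_powP n (a : O) : ideal_pow p n a <-> in_local (val a / pi ^+ n).
Proof.
split=> [[m [c [F [Fp ->]]]]|[b [s [sp eb]]]].
  rewrite rmorph_sum mulr_suml; apply: (big_ind in_local); last first.
  - move=> i _; rewrite rmorphM -mulrA; apply: in_localM; first exact: in_local_val.
    rewrite rmorph_prod -[n in pi ^+ n]card_ord -prodr_const -prodf_div.
    apply: (big_ind in_local); [exact: in_local1|exact: in_localM|].
    by move=> j _; apply/t_unif/in_max_val.
  - exact: in_localD.
  - exact/in_max_local/in_max0.
have {}eb : s * a = t ^+ n * b.
  apply: algint_inj; rewrite !rmorphM rmorphXn /= eb; field.
  by rewrite expf_neq0.
have [u up] := prime_ideal_maximal l_pr lp sp.
pose w := \sum_(i < n) (1 - s * u) ^+ i.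
have sw : 1 - (1 - s * u) ^+ n = s * (u * w).
  by rewrite -opprB subrX1 -/w; ring.
(* As [1 - (1 - s u)^n = s u w] and [s a = t^n b], the element [a] is the sum of [a (1 - s u)^n] and
   [u w b t^n]. *)
exists 2, (fun i : 'I_2 => if i == 0 :> nat then a else u * w * b),
  (fun i : 'I_2 => fun=> if i == 0 :> nat then 1 - s * u else t).
split; first by move=> i j; case: ifP.
rewrite !big_ord_recl big_ord0 /= addr0 !prodr_const !card_ord.
have -> : u * w * b * t ^+ n = a * (1 - (1 - s * u) ^+ n).
  by rewrite sw -mulrA [b * _]mulrC -eb; ring.
by set e := _ ^+ n; ring.
Qed.

Lemma ordp_eq (a : O) (k : nat) (u : K) : local_unit u ->
  val a = pi ^+ k * u -> ordp p a = k.
Proof.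
move=> uu ea.
have E n : ideal_pow p n a <-> (n <= k)%N.
  rewrite ideal_powP ea.
  have -> : pi ^+ k * u / pi ^+ n = pi ^ (k%:Z - n%:Z) * u.
    by rewrite mulrAC expfzDr // -exprnN.
  by rewrite in_local_factor // subr_ge0 lez_nat.
apply: xget_unique => [|n] /=; first by rewrite !E ltnn; split.
by rewrite !E => -[le /negP]; rewrite -leqNgt => ge; apply/eqP; rewrite eqn_leq le.
Qed.

Lemma ordp_unit (a : O) : local_unit (val a) -> ordp p a = 0%N.
Proof. by move=> au; apply: (ordp_eq au); rewrite expr0 mul1r. Qed.

(** The set defining [valp] is the singleton of [k]: one fraction for [x] is exhibited, and any
    other gives the same difference of orders. *)
Lemma valp_eq (x : K) (k : int) (u : K) : local_unit u ->
  x = pi ^ k * u -> valp p x = k%:E.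
Proof.
move=> uu ex; have [u0 ul uVl] := uu; rewrite /valp.
have x0 : x != 0 by rewrite ex mulf_neq0 // expfz_neq0.
rewrite (negPf x0); congr (_%:E); apply: xget_unique => [|h] /=.
  have [a [s [sp eu]]] := ul; have su := local_unit_notin sp.
  have [s0 _ _] := su.
  have ux : u = val a / val s by rewrite eu mulfK.
  have au : local_unit (val a) by rewrite eu; apply: local_unitM.
  have [a0 _ _] := au.
  case: k ex => k ex.
    exists (t ^+ k * a), s; split.
    - by rewrite -algint_val_eq0 rmorphM rmorphXn /= mulf_neq0 // expf_neq0.
    - by rewrite -algint_val_eq0.
    - by rewrite ex ux rmorphM rmorphXn mulrA.
    - rewrite (ordp_eq au (k := k)) ?rmorphM ?rmorphXn //.
      by rewrite ordp_unit // subr0.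
  exists a, (t ^+ k.+1 * s); split.
  - by rewrite -algint_val_eq0.
  - by rewrite -algint_val_eq0 rmorphM rmorphXn /= mulf_neq0 // expf_neq0.
  - by rewrite ex ux rmorphM rmorphXn invfM NegzE -exprnN mulrCA mulrA.
  - rewrite (ordp_eq (a := t ^+ k.+1 * s) su (k := k.+1)) ?rmorphM ?rmorphXn //.
    by rewrite ordp_unit // sub0r NegzE.
move=> [a [b [a0 b0 exab ->]]].
have va0 : val a != 0 by rewrite algint_val_eq0.
have vb0 : val b != 0 by rewrite algint_val_eq0.
have [i [v [vu ea]]] := local_factor (in_local_val p a) va0.
have [j [w [wu eb]]] := local_factor (in_local_val p b) vb0.
rewrite (ordp_eq vu ea) (ordp_eq wu eb).
have [v0 _ _] := vu; have [w0 _ _] := wu.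
(* Comparing both exponents of [x] writes 1 as a unit times [pi] to their difference, which must
   then be 0. *)
have e1 : 1 = pi ^ (k - (i%:Z - j%:Z)) * (u * w / v).
  have : pi ^ k * u * (pi ^+ j * w) = pi ^+ i * v.
    by rewrite -ex -ea -eb exab divfK.
  have pi0 n : pi ^+ n != 0 by rewrite expf_neq0.
  rewrite opprB !expfzDr // -exprnN -exprnP.
  move: (pi ^ k) (pi ^+ i) (pi ^+ j) (pi0 i) (pi0 j) => P Pi Pj Pi0 Pj0 H.
  apply: (mulfI (mulf_neq0 Pi0 v0)); rewrite mulr1 -{1}H; field.
  by rewrite v0.
have uwv : local_unit (u * w / v).
  by apply: local_unitM; [apply: local_unitM|apply: local_unitV].
have := in_local1 p; rewrite e1 => /(in_local_factor _ uwv) ge.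
have : ~ in_max 1 by apply: in_max1.
rewrite e1 => /(in_max_factor _ uwv) ngt; lia.
Qed.

End Valuation.

(** * Valuation inequalities as membership in the localization *)

Section ValuationOrder.
Variables (K : fieldExtType rat) (p : prime_idealr (ringOfIntegers K)).
Hypothesis hp : nonzero_ideal p.
Local Notation in_local := (in_local p).
Local Notation in_max := (in_max p).

Lemma in_local_or_inv (x : K) : in_local x \/ in_local x^-1.
Proof.
by have [l l_pr lp] := nonzero_ideal_prime hp; apply: in_local_total lp _.
Qed.

(** A valuation ring is integrally closed: otherwise [x^-1] would lie in the maximal ideal, and so
    would [1 = x^n x^-n]. *)
Lemma in_local_root (x : K) n : (0 < n)%N -> in_local (x ^+ n) -> in_local x.
Proof.
case: n => // n _ xnl; have [//|xV] := in_local_or_inv x.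
apply: contrapT => nx; have x0 : x != 0.
  by apply: contra_notN nx => /eqP ->; apply/in_max_local/in_max0.
have xVm : in_max x^-1.
  by apply: contrapT => /(in_local_inv xV); rewrite invrK.
apply: (@in_max1 _ p); rewrite -(mulVf (expf_neq0 n.+1 x0)) -exprVn.
apply: in_maxMr => //; rewrite exprS; apply: in_maxMr => //; exact: in_localX.
Qed.

Lemma valp_ge (x y : K) : x != 0 ->
  (valp p x <= valp p y)%E <-> in_local (y / x).
Proof.
have [l l_pr lp] := nonzero_ideal_prime hp.
have [t [tp t0 tu]] := uniformizer_exists l_pr lp.
have pi0 := pi_neq0 t0.
move=> x0; have [->|y0] := eqVneq y 0.
  rewrite mul0r {2}/valp eqxx leey; split=> // _; exact/in_max_local/in_max0.
have [k [u [uu ex]]] := factor l_pr lp tp t0 tu x0.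
have [h [v [vu ey]]] := factor l_pr lp tp t0 tu y0.
rewrite (valp_eq l_pr lp tp t0 tu uu ex) (valp_eq l_pr lp tp t0 tu vu ey) lee_fin.
have -> : y / x = algint_val t ^ (h - k) * (v / u).
  rewrite ex ey expfzDr // -invr_expz invfM; ring.
have vuu : local_unit p (v / u) by apply: local_unitM => //; apply: local_unitV.
by rewrite (in_local_factor tp t0 _ vuu) subr_ge0.
Qed.

Lemma valp1 : valp p 1 = 0%E.
Proof.
have [l l_pr lp] := nonzero_ideal_prime hp.
have [t [tp t0 tu]] := uniformizer_exists l_pr lp.
by apply: (valp_eq l_pr lp tp t0 tu (local_unit1 p)); rewrite expr0z mulr1.
Qed.

Lemma valp_ge0 (x : K) : (0 <= valp p x)%E <-> in_local x.
Proof. by rewrite -valp1 valp_ge ?oner_eq0 // divr1. Qed.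

Lemma valp_gt0 (x : K) : (0 < valp p x)%E <-> in_max x.
Proof.
have [->|x0] := eqVneq x 0.
  by rewrite /valp eqxx lt0y; split=> // _; apply: in_max0.
rewrite ltNge -valp1; split=> [/negP|xm].
  rewrite valp_ge // div1r => nx; have [xl|//] := in_local_or_inv x.
  by apply: contrapT => /(in_local_inv xl).
apply/negP; rewrite valp_ge // div1r => xV; apply: (@in_max1 _ p).
by rewrite -(mulfV x0); apply: in_maxMr.
Qed.

End ValuationOrder.

(** * Weierstrass models *)

Section ChangeOfVariables.
Variable K : fieldType.
Implicit Types (W : weierstrass K) (P Q : option (K * K)).

Lemma weierstrass_eq W W' : wa1 W = wa1 W' -> wa2 W = wa2 W' ->
  wa3 W = wa3 W' -> wa4 W = wa4 W' -> wa6 W = wa6 W' -> W = W'.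
Proof. by case: W W' => [????? [?????]] /= -> -> -> -> ->. Qed.

Lemma wdisc_change_vars W u r s t : u != 0 ->
  wdisc (change_vars W u r s t) = wdisc W / u ^+ 12.
Proof. by move=> u0; rewrite /wdisc /wb2 /wb4 /wb6 /wb8 /=; field. Qed.

Lemma wc4_change_vars W u r s t : u != 0 ->
  wc4 (change_vars W u r s t) = wc4 W / u ^+ 4.
Proof. by move=> u0; rewrite /wc4 /wb2 /wb4 /=; field. Qed.

Lemma model_of_trans W W' W'' : model_of W W' -> model_of W' W'' ->
  model_of W W''.
Proof.
move=> [u [r [s [t [u0 ->]]]]] [u' [r' [s' [t' [u'0 ->]]]]].
exists (u * u'), (u ^+ 2 * r' + r), (u * s' + s),
  (u ^+ 3 * t' + u ^+ 2 * s * r' + t).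
by split; [rewrite mulf_neq0|apply: weierstrass_eq => /=; field; rewrite u0 u'0].
Qed.

Lemma model_of_sym W W' : model_of W W' -> model_of W' W.
Proof.
move=> [u [r [s [t [u0 ->]]]]].
exists u^-1, (- r / u ^+ 2), (- s / u), ((r * s - t) / u ^+ 3).
by split; [rewrite invr_eq0|apply: weierstrass_eq => /=; field; rewrite u0 ?oner_eq0].
Qed.

Lemma wdisc_model_of W W' : model_of W W' -> wdisc W != 0 -> wdisc W' != 0.
Proof.
move=> [u [r [s [t [u0 ->]]]]] d0.
by rewrite wdisc_change_vars // mulf_neq0 // invr_eq0 expf_neq0.
Qed.

Definition change_point (u r s t : K) P : option (K * K) :=
  omap (fun xy => ((xy.1 - r) / u ^+ 2, (xy.2 - s * (xy.1 - r) - t) / u ^+ 3)) P.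

Lemma change_point_inj u r s t : u != 0 -> injective (change_point u r s t).
Proof.
move=> u0 [[x y]|] [[x' y']|] //= [ex ey].
have {}ex : x = x'.
  by apply: (addIr (- r)); apply: (mulIf _ ex); rewrite invr_eq0 expf_neq0.
move: ey; rewrite ex => ey; have := mulIf _ ey.
by rewrite invr_eq0 expf_neq0 // => /(_ isT)/addIr/addIr->.
Qed.

Lemma on_curve_change_point W u r s t P : u != 0 -> on_curve W P ->
  on_curve (change_vars W u r s t) (change_point u r s t P).
Proof.
move=> u0; case: P => [[x y]|] //= /eqP e; apply/eqP.
have -> : wa6 W = y ^+ 2 + wa1 W * x * y + wa3 W * y
  - (x ^+ 3 + wa2 W * x ^+ 2 + wa4 W * x) by rewrite e; ring.
by field.
Qed.

Lemma on_curve_same_x W x y1 y2 : on_curve W (Some (x, y1)) ->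
  on_curve W (Some (x, y2)) -> y1 = y2 \/ y1 + y2 + wa1 W * x + wa3 W = 0.
Proof.
move=> /eqP h1 /eqP h2.
have /eqP : (y1 - y2) * (y1 + y2 + wa1 W * x + wa3 W) = 0.
  transitivity ((y1 ^+ 2 + wa1 W * x * y1 + wa3 W * y1)
    - (y2 ^+ 2 + wa1 W * x * y2 + wa3 W * y2)); first by ring.
  by rewrite h1 h2 subrr.
by rewrite mulf_eq0 subr_eq0 => /orP[]/eqP; [left|right].
Qed.

(** The substitution is affine and preserves vertical lines, so chords and tangents correspond, a
    slope [l] becoming [(l - s) / u]. *)
Lemma add_raw_change_point W u r s t P Q : u != 0 ->
  on_curve W P -> on_curve W Q ->
  add_raw (change_vars W u r s t) (change_point u r s t P) (change_point u r s t Q)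
  = change_point u r s t (add_raw W P Q).
Proof.
move=> u0; case: P => [[x1 y1]|] //; case: Q => [[x2 y2]|] // cP cQ.
rewrite /add_raw /=.
have u2 : (u ^+ 2)^-1 != 0 by rewrite invr_eq0 expf_neq0.
have -> : ((x1 - r) / u ^+ 2 == (x2 - r) / u ^+ 2) = (x1 == x2).
  by rewrite (inj_eq (mulIf u2)) (inj_eq (addIr _)).
have [ex|x12] /= := eqVneq x1 x2; last first.
  have x21 : x2 - x1 != 0 by rewrite subr_eq0 eq_sym.
  have -> : ((y2 - s * (x2 - r) - t) / u ^+ 3 - (y1 - s * (x1 - r) - t) / u ^+ 3)
      / ((x2 - r) / u ^+ 2 - (x1 - r) / u ^+ 2)
      = ((y2 - y1) / (x2 - x1) - s) / u.
    have -> : y2 = (y2 - y1) / (x2 - x1) * (x2 - x1) + y1 by rewrite divfK // subrK.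
    move: ((y2 - y1) / (x2 - x1)) => l; move: (x2 - x1) x21 (subrK x1 x2) => d d0 <-.
    rewrite addrK mulfK //; field.
    by rewrite u0 (_ : _ - _ = d) //; ring.
  by move: (_ / (x2 - x1)) => l; congr (Some (_, _)); field.
subst x2.
have [<- {y2 cQ}|ey] := on_curve_same_x cP cQ; last first.
  have -> : (y1 - s * (x1 - r) - t) / u ^+ 3 + (y2 - s * (x1 - r) - t) / u ^+ 3
      + (wa1 W + 2 * s) / u * ((x1 - r) / u ^+ 2) + (wa3 W + r * wa1 W + 2 * t) / u ^+ 3
      = (y1 + y2 + wa1 W * x1 + wa3 W) / u ^+ 3 by field.
  by rewrite ey mul0r eqxx.
have -> : (y1 - s * (x1 - r) - t) / u ^+ 3 + (y1 - s * (x1 - r) - t) / u ^+ 3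
    + (wa1 W + 2 * s) / u * ((x1 - r) / u ^+ 2) + (wa3 W + r * wa1 W + 2 * t) / u ^+ 3
    = (2 * y1 + wa1 W * x1 + wa3 W) / u ^+ 3 by field.
have -> : y1 + y1 + wa1 W * x1 + wa3 W = 2 * y1 + wa1 W * x1 + wa3 W by ring.
rewrite mulf_eq0 invr_eq0 expf_eq0 (negPf u0) andbF orbF.
case: eqVneq => //= D0.
set l := (_ / (2 * y1 + wa1 W * x1 + wa3 W)).
set l' := (_ / (2 * (_ / _) + _ + _)).
have -> : l' = (l - s) / u.
  by rewrite /l' /l; field; rewrite u0.
by clearbody l; congr (Some (_, _)); field.
Qed.

(** Raw coordinates replace [points] here, so that a change of model is plain composition. *)
Definition point_hom (T : zmodType) W (f : T -> option (K * K)) : Prop :=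
  [/\ injective f, forall g, on_curve W (f g)
    & forall g h, f (g + h) = add_raw W (f g) (f h)].

Lemma point_hom_change (T : zmodType) W u r s t (f : T -> option (K * K)) :
  u != 0 -> point_hom W f ->
  point_hom (change_vars W u r s t) (change_point u r s t \o f).
Proof.
move=> u0 [injf curf addf]; split=> [|g|g h] /=.
- exact/inj_comp/injf/change_point_inj.
- exact: on_curve_change_point.
- by rewrite addf add_raw_change_point.
Qed.

Section Torsion.
Variables (T : zmodType) (W : weierstrass K) (f : T -> option (K * K)).
Hypothesis fP : point_hom W f.

(** An affine point equal to its double would satisfy [2 y + a1 x + a3 = 0], so its double would be
    infinity. *)
Lemma point_hom0 : f 0 = None.
Proof.
have [_ _ fD] := fP; have := fD 0 0; rewrite addr0.
case: (f 0) => [[x y]|] //=; rewrite eqxx /=; case: eqVneq => // n0.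
move=> [ex ey]; case/eqP: n0; rewrite -ex in ey.
by rewrite {1}ey; ring.
Qed.

Lemma point_hom_neq0 g : g != 0 -> exists xy, f g = Some xy.
Proof.
have [fI _ _] := fP; case E: (f g) => [xy|]; first by exists xy.
by rewrite -{1}point_hom0 in E; move/fI: E => ->; rewrite eqxx.
Qed.

(** Source of the torsion equations: splitting [n g = 0] as [i g + j g = 0] compares the coordinates
    of two multiples. *)
Lemma point_hom_opp g h x y x' y' : g + h = 0 ->
  f g = Some (x, y) -> f h = Some (x', y') ->
  x = x' /\ y + y' + wa1 W * x + wa3 W = 0.
Proof.
move=> gh eg eh; have [_ _ fD] := fP; have := fD g h.
rewrite gh point_hom0 eg eh /=; case: eqVneq => //= <-.
by case: eqVneq.
Qed.

Lemma point_hom_same_x g h x y x' y' : f g = Some (x, y) -> f h = Some (x', y') ->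
  g != h -> g + h != 0 -> x != x'.
Proof.
have [fI fC fD] := fP; move=> eg eh gh; apply: contraNneq => exx; subst x'.
apply/eqP/fI; rewrite point_hom0 fD eg eh /= eqxx /=.
have cg := fC g; have ch := fC h; rewrite eg in cg; rewrite eh in ch.
have [ey|->] := on_curve_same_x cg ch; last by rewrite eqxx.
by case/eqP: gh; apply: fI; rewrite eg eh ey.
Qed.

End Torsion.

(** The marked point is [(0, 0)], where the tangent is [y = 0] when [b] is nonzero. *)
Definition tate (b c : K) : weierstrass K := Weierstrass (1 - c) (- b) (- b) 0 0.

(* Moving a point [g] of order at least 4 to the origin with horizontal
   tangent leaves [y^2 + a1 x y + a3 y = x^3 + a2 x^2] with [a2], [a3] nonzero,
   and [u = a3 / a2] makes them equal. *)
Lemma tate_normal_form (T : zmodType) W (f : T -> option (K * K)) g :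
  point_hom W f -> g != 0 -> g + g != 0 -> g + g + g != 0 ->
  exists b c (f' : T -> option (K * K)),
    [/\ model_of W (tate b c), point_hom (tate b c) f' & f' g = Some (0, 0)].
Proof.
move=> fP g0 g20 g30; have [fI fC fD] := fP.
have [[x y] eg] := point_hom_neq0 fP g0.
have D0 : 2 * y + wa1 W * x + wa3 W != 0.
  apply: contraNneq g20 => D0; apply/eqP/fI.
  rewrite (point_hom0 fP) fD eg /= eqxx /=; case: eqP => // -[].
  by rewrite -[RHS]D0; ring.
pose l := (3 * x ^+ 2 + 2 * wa2 W * x + wa4 W - wa1 W * y) / (2 * y + wa1 W * x + wa3 W).
have eg2 : exists z, f (g + g) = Some (l ^+ 2 + wa1 W * l - wa2 W - x - x, z).
  rewrite fD eg /= eqxx /=; case: eqP => [D|_]; last by eexists.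
  by case/eqP: D0; rewrite -[RHS]D; ring.
have [z {}eg2] := eg2.
(* The new [a2] is [x(g) - x(2 g)], nonzero because neither [g] nor [3 g] vanishes. *)
pose a2 := wa2 W - l * wa1 W + 3 * x - l ^+ 2.
have a20 : a2 != 0.
  have gg : g + g != g by apply: contraNneq g0 => /eqP; rewrite -subr_eq0 addrK.
  have := point_hom_same_x fP eg2 eg gg g30; apply: contraNneq => a20.
  by apply/eqP/subr0_eq; rewrite -[RHS]oppr0 -a20 /a2; ring.
pose a3 := wa3 W + x * wa1 W + 2 * y.
have a3D : 2 * y + wa1 W * x + wa3 W = a3 by rewrite /a3; ring.
have a30 : a3 != 0 by rewrite -a3D.
have u0 : a3 / a2 != 0 by rewrite mulf_neq0 // invr_eq0.
pose u := a3 / a2.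
have eW : change_vars W u x l y = tate (- (a2 ^+ 3 / a3 ^+ 2)) (1 - (wa1 W + 2 * l) / u).
  apply: weierstrass_eq => /=; rewrite -/a2 -/a3.
  - by rewrite subKr.
  - by rewrite /u; field; rewrite a20 a30.
  - by rewrite /u; field; rewrite a20 a30.
  (* The new [a4] vanishes because [l] is the slope of the tangent; [a6], next, because the point is
     on the curve. *)
  - suff -> : wa4 W - l * wa3 W + 2 * x * wa2 W - (y + x * l) * wa1 W
      + 3 * x ^+ 2 - 2 * l * y = 0 by rewrite mul0r.
    have : l * (2 * y + wa1 W * x + wa3 W)
        = 3 * x ^+ 2 + 2 * wa2 W * x + wa4 W - wa1 W * y by rewrite divfK.
    by move/eqP; rewrite -subr_eq0 => /eqP e; rewrite -[RHS]oppr0 -e; ring.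
  - suff -> : wa6 W + x * wa4 W + x ^+ 2 * wa2 W + x ^+ 3 - y * wa3 W - y ^+ 2
      - x * y * wa1 W = 0 by rewrite mul0r.
    have := fC g; rewrite eg /= => /eqP/eqP.
    by rewrite -subr_eq0 => /eqP e; rewrite -[RHS]oppr0 -e; ring.
exists (- (a2 ^+ 3 / a3 ^+ 2)), (1 - (wa1 W + 2 * l) / u), (change_point u x l y \o f).
split; rewrite -?eW.
- by exists u, x, l, y.
- exact: point_hom_change.
- by rewrite /= eg /= !subrr mulr0 subr0 subrr !mul0r.
Qed.

End ChangeOfVariables.

(** * Multiples of the marked point of a Tate normal form *)

Section TateMultiples.
Variables (K : fieldType) (T : zmodType) (b c : K) (f : T -> option (K * K)) (g : T).
Hypotheses (fP : point_hom (tate b c) f) (fg : f g = Some (0, 0)) (b0 : b != 0).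

Lemma tate_mul2 : f (g *+ 2) = Some (b, b * c).
Proof.
have [_ _ fD] := fP; rewrite mulr2n fD fg /= eqxx /=.
have -> : 0 + 0 + (1 - c) * 0 - b = - b by ring.
rewrite oppr_eq0 (negPf b0); set l := _ / _.
have -> : l = 0 by rewrite /l (_ : _ - _ = 0) ?mul0r //; ring.
by congr (Some (_, _)); ring.
Qed.

Lemma tate_mul3 : f (g *+ 3) = Some (c, b - c).
Proof.
have [_ _ fD] := fP; rewrite mulrS fD fg tate_mul2 /= eq_sym (negPf b0) /=.
rewrite !subr0 [b * c]mulrC mulfK //.
by congr (Some (_, _)); ring.
Qed.

(** With [d = b / c], the chord through [g] and [3 g] has slope [d - 1], and the coordinates become
    polynomials. *)
Lemma tate_mul4 d : c != 0 -> b = c * d ->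
  f (g *+ 4) = Some (d * (d - 1), d ^+ 2 * (c - d + 1)).
Proof.
move=> c0 bE; have [_ _ fD] := fP.
rewrite mulrS fD fg tate_mul3 /= eq_sym (negPf c0) /= !subr0.
have -> : (b - c) / c = d - 1 by rewrite bE; field.
by rewrite bE; congr (Some (_, _)); ring.
Qed.

(** Likewise [e = c / (d - 1)] serves for the chord through [g] and [4 g], of slope [d (e - 1)]. *)
Lemma tate_mul5 d e : c != 0 -> b = c * d -> d - 1 != 0 -> c = e * (d - 1) ->
  exists y, f (g *+ 5) = Some (d * e * (e - 1), y).
Proof.
move=> c0 bE d10 cE; have [_ _ fD] := fP.
have d0 : d != 0 by apply: contraNneq b0 => d0; rewrite bE d0 mulr0.
rewrite mulrS fD fg (tate_mul4 c0 bE) /= eq_sym mulf_eq0 (negPf d0) (negPf d10) /=.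
have -> : (d ^+ 2 * (c - d + 1) - 0) / (d * (d - 1) - 0) = d * (e - 1).
  by rewrite cE; field; rewrite d0 d10.
by eexists; congr (Some (_, _)); rewrite bE cE; ring.
Qed.

(** [2 g] is its own opposite, which reads [b c = 0]. *)
Lemma tate_order4 : g *+ 4 = 0 -> c = 0.
Proof.
rewrite (mulrnDr g 2 2) => g4.
have [_ e] := point_hom_opp fP g4 tate_mul2 tate_mul2.
by apply: (mulfI b0); rewrite mulr0 -[RHS]e /=; ring.
Qed.

Lemma tate_order5 : g *+ 5 = 0 -> b = c.
Proof.
rewrite (mulrnDr g 2 3) => g5.
by have [] := point_hom_opp fP g5 tate_mul2 tate_mul3.
Qed.

Lemma tate_order6 : g *+ 6 = 0 -> b = c + c ^+ 2.
Proof.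
rewrite (mulrnDr g 3 3) => g6.
have [_ /= e] := point_hom_opp fP g6 tate_mul3 tate_mul3.
by apply/subr0_eq; rewrite -[RHS]e; ring.
Qed.

Lemma tate_c_neq0 : g *+ 2 != 0 -> g *+ 4 != 0 -> c != 0.
Proof.
move=> g2 g4; apply: (point_hom_same_x fP tate_mul3 fg); last by rewrite -mulrSr.
by rewrite mulrSr -subr_eq0 addrK.
Qed.

Lemma tate_order7 : g *+ 2 != 0 -> g *+ 4 != 0 -> g *+ 7 = 0 ->
  exists d, c = d * (d - 1) /\ b = c * d.
Proof.
move=> g2 g4; rewrite (mulrnDr g 3 4) => g7; have c0 := tate_c_neq0 g2 g4.
have bE : b = c * (b / c) by rewrite mulrC divfK.
exists (b / c); split=> //.
by have [] := point_hom_opp fP g7 tate_mul3 (tate_mul4 c0 bE).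
Qed.

(** [4 g] is its own opposite; after division by [d = b / c] the equation is linear in [c]. *)
Lemma tate_order8 : g *+ 2 != 0 -> g *+ 4 != 0 -> g *+ 8 = 0 ->
  exists d, d != 0 /\ c = (2 * d - 1) * (d - 1) / d /\ b = (2 * d - 1) * (d - 1).
Proof.
move=> g2 g4; rewrite (mulrnDr g 4 4) => g8; have c0 := tate_c_neq0 g2 g4.
have bE : b = c * (b / c) by rewrite mulrC divfK.
have d0 : b / c != 0 by rewrite mulf_neq0 // invr_eq0.
move: (b / c) bE d0 => d bE d0; exists d.
have [_ /= e] := point_hom_opp fP g8 (tate_mul4 c0 bE) (tate_mul4 c0 bE).
have e' : c * d = (2 * d - 1) * (d - 1).
  by apply/subr0_eq/(mulfI d0); rewrite mulr0 -[RHS]e bE; ring.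
by rewrite -e' mulfK.
Qed.

(** [4 g] and [5 g] are opposite; equating their abscissas gives [d] in terms of [e]. *)
Lemma tate_order9 : g *+ 2 != 0 -> g *+ 3 != 0 -> g *+ 4 != 0 -> g *+ 5 != 0 ->
  g *+ 9 = 0 ->
  exists e, c = e ^+ 2 * (e - 1) /\ b = c * (e ^+ 2 - e + 1).
Proof.
move=> g2 g3 g4 g5; rewrite (mulrnDr g 4 5) => g9; have c0 := tate_c_neq0 g2 g4.
have bE : b = c * (b / c) by rewrite mulrC divfK.
have d0 : b / c != 0 by rewrite mulf_neq0 // invr_eq0.
move: (b / c) bE d0 => d bE d0.
have d10 : d - 1 != 0.
  have : d * (d - 1) != 0.
    apply: (point_hom_same_x fP (tate_mul4 c0 bE) fg); last by rewrite -mulrSr.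
    by rewrite mulrSr -subr_eq0 addrK.
  by rewrite mulf_eq0 negb_or => /andP[].
have cE : c = c / (d - 1) * (d - 1) by rewrite divfK.
move: (c / (d - 1)) cE => e cE; exists e.
have [y m5] := tate_mul5 c0 bE d10 cE.
have [H _] := point_hom_opp fP g9 (tate_mul4 c0 bE) m5.
have dE : d = e ^+ 2 - e + 1.
  apply/subr0_eq/(mulfI d0); rewrite mulr0; apply/eqP.
  by move/eqP: H; rewrite -subr_eq0; congr (_ == 0); ring.
by rewrite -dE; split=> //; rewrite cE dE; ring.
Qed.

(* The quadratic [4 x^2 + x - b] vanishes at the x-coordinates of the points of
   order 2 other than [2 g]. *)
Lemma tate_order2x4 h : c = 0 -> h != 0 -> h + h = 0 -> h != g *+ 2 ->
  exists q, b = q * (4 * q + 1).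
Proof.
move=> c0 h0 h2 hg; have [_ fC _] := fP.
have [[x y] eh] := point_hom_neq0 fP h0; exists x.
have [_ /= e] := point_hom_opp fP h2 eh eh.
have hg' : h + g *+ 2 != 0.
  by apply: contraNneq hg => e'; apply/eqP/(@addrI _ h); rewrite h2.
have xb := point_hom_same_x fP eh tate_mul2 hg hg'.
have := fC h; rewrite eh c0 /= => /eqP cu; rewrite c0 in e.
(* On the curve [(2 y + x - b)^2 = 4 x^2 (x - b) + (x - b)^2], and the left side vanishes at a point
   of order 2. *)
have : (x - b) * (4 * x ^+ 2 + x - b) = 0.
  transitivity ((y + y + (1 - 0) * x + - b) ^+ 2 - 4 * (y ^+ 2 + (1 - 0) * x * y + - b * y)
    + 4 * (x ^+ 3 + - b * x ^+ 2 + 0 * x + 0)); first by ring.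
  by rewrite e cu; ring.
move/eqP; rewrite mulf_eq0 !subr_eq0 (negPf xb) /= => /eqP <-.
by ring.
Qed.

End TateMultiples.

(** * Families with prescribed torsion *)

(* Tate normal forms with the parameter written [b / a] and scaled so that the
   coefficients become binary forms in [a] and [b]. *)
Section Families.
Variable K : fieldType.

Definition family5 (a b : K) : weierstrass K :=
  Weierstrass (a - b) (- (a * b))
    (- (a ^+ 2 * b)) 0 0.

Definition family6 (a b : K) : weierstrass K :=
  Weierstrass (a - b) (- (b * (a + b)))
    (- (a * b * (a + b))) 0 0.

Definition family7 (a b : K) : weierstrass K :=
  Weierstrass (a ^+ 2 - b * (b - a)) (- (a * b ^+ 2 * (b - a)))
    (- (a ^+ 3 * b ^+ 2 * (b - a))) 0 0.

Definition family8 (a b : K) : weierstrass K :=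
  Weierstrass (a * b - (2 * b - a) * (b - a)) (- (b ^+ 2 * ((2 * b - a) * (b - a))))
    (- (a * b ^+ 3 * ((2 * b - a) * (b - a)))) 0 0.

Definition family9 (a b : K) : weierstrass K :=
  Weierstrass (a ^+ 3 - b ^+ 2 * (b - a)) (- (a * b ^+ 2 * (b - a) * (b ^+ 2 - a * b + a ^+ 2)))
    (- (a ^+ 4 * b ^+ 2 * (b - a) * (b ^+ 2 - a * b + a ^+ 2))) 0 0.

Definition family2x4 (a b : K) : weierstrass K :=
  Weierstrass a (- (b * (4 * b + a)))
    (- (a * b * (4 * b + a))) 0 0.

End Families.

(** * Radicals and Bezout identities modulo a prime *)

Section Primitive.
Variables (K : fieldExtType rat) (p : prime_idealr (ringOfIntegers K)).
Local Notation in_local := (in_local p).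
Local Notation in_max := (in_max p).

Lemma in_local_nat n : in_local n%:R.
Proof. exact: (in_local_int p n). Qed.

Lemma not_in_maxM x y : in_local x -> in_local y -> ~ in_max x -> ~ in_max y ->
  ~ in_max (x * y).
Proof. by move=> xl yl nx ny /(in_maxM xl yl)[]. Qed.

Lemma not_in_maxX x n : in_local x -> ~ in_max x -> ~ in_max (x ^+ n).
Proof. by move=> xl nx /(in_maxX xl). Qed.

(** Passing from the discriminant to its radical lowers the degree of the Bezout identities; [s]
    lists factors with multiplicities. *)
Lemma in_max_rad (s : seq (K * nat)) :
  in_max (\prod_(x <- s) x.1 ^+ x.2) ->
  foldr (fun x P => in_local x.1 /\ P) True s -> in_max (\prod_(x <- s) x.1).
Proof.
suff H : foldr (fun x P => in_local x.1 /\ P) True s ->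
    [/\ in_local (\prod_(x <- s) x.1 ^+ x.2), in_local (\prod_(x <- s) x.1)
      & in_max (\prod_(x <- s) x.1 ^+ x.2) -> in_max (\prod_(x <- s) x.1)].
  by move=> sm /H[_ _]; apply.
elim: s => [|x s IHs] /=.
  by move=> _; rewrite !big_nil; split=> //; apply: in_local1.
move=> [xl /IHs[sl sl' sm]]; rewrite !big_cons; split.
- by apply: in_localM => //; apply: in_localX.
- exact: in_localM.
- move/(in_maxM (in_localX _ xl) sl) => [/(in_maxX xl) xm|/sm ?].
    exact: in_maxMr.
  exact: in_maxMl.
Qed.

(** Meant for [R] a radical, [C] the invariant [c4] and [N] a product of primes outside the maximal
    ideal, modulo which the identity leaves [N a^k = 0]. *)
Lemma bezout_in_max (N a : K) (k : nat) (U V R C : K) :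
  in_local N -> ~ in_max N -> in_local a -> in_local U -> in_local V ->
  in_max R -> in_max C -> N * a ^+ k = U * R + V * C -> in_max a.
Proof.
move=> Nl Nm al Ul Vl Rm Cm e; apply: (in_maxX (n := k) al).
have : in_max (N * a ^+ k) by rewrite e; apply: in_maxD; apply: in_maxMl.
by case/(in_maxM Nl (in_localX k al)).
Qed.

End Primitive.

Ltac local_ring :=
  lazymatch goal with
  | |- in_local _ (_ + _) => apply: in_localD; local_ring
  | |- in_local _ (- _) => apply: in_localN; local_ring
  | |- in_local _ (_ * _) => apply: in_localM; local_ring
  | |- in_local _ (_ ^+ _) => apply: in_localX; local_ring
  | |- in_local _ (_ *+ _) => apply: in_local_nat
  | |- in_local _ _ => first [assumption | exact: in_local1]
  | |- ~ in_max _ (_ * _) => apply: not_in_maxM; local_ring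
  | |- ~ in_max _ (_ ^+ _) => apply: not_in_maxX; local_ring
  | |- ~ in_max _ _ => first [assumption | exact: in_max1]
  | |- _ /\ _ => split; local_ring
  | |- True => exact: I
  end.

(* In the next lemmas the cofactors of the Bezout identities between the radical
   of the discriminant and c4 solve a Sylvester system; large literals are split
   because [n%:R] is unary. *)
Section PrimitiveFamilies.
Variables (K : fieldExtType rat) (p : prime_idealr (ringOfIntegers K)).
Local Notation in_local := (in_local p).
Local Notation in_max := (in_max p).

Lemma family5_primitive a b : in_local a -> in_local b -> ~ in_max 5 ->
  in_max (wdisc (family5 a b)) -> in_max (wc4 (family5 a b)) -> in_max a /\ in_max b.
Proof.
move=> al bl n5 hD hC.
pose s := [:: (a, 5%N); (b, 5%N); (a ^+ 2 + 11 * a * b - b ^+ 2, 1%N)].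
have e : \prod_(x <- s) x.1 ^+ x.2 = - wdisc (family5 a b).
  by rewrite !big_cons big_nil /wdisc /wb2 /wb4 /wb6 /wb8 /=; ring.
have hR : in_max (\prod_(x <- s) x.1).
  apply: in_max_rad; last by rewrite /=; local_ring.
  by rewrite e; apply: in_maxN.
rewrite !big_cons big_nil /= in hR.
split.
(* In each family the exponent is one less than the sum of the degrees of the radical and of [c4],
   here 4 and 4. *)
- apply: (@bezout_in_max _ _ (5 ^+ 1) _ 7
    (1238 * a ^+ 3 + 1771 * a ^+ 2 * b - 1415 * a * b ^+ 2 + 117 * b ^+ 3)
    (5 * a ^+ 3 - 1298 * a ^+ 2 * b + 117 * a * b ^+ 2) _ _ _ _ _ _ _ hR hC); try local_ring.
  by rewrite /wc4 /wb2 /wb4 /=; ring.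
- apply: (@bezout_in_max _ _ (5 ^+ 1) _ 7
    (-117 * a ^+ 3 - 1415 * a ^+ 2 * b - 1771 * a * b ^+ 2 + 1238 * b ^+ 3)
    (117 * a ^+ 2 * b + 1298 * a * b ^+ 2 + 5 * b ^+ 3) _ _ _ _ _ _ _ hR hC); try local_ring.
  by rewrite /wc4 /wb2 /wb4 /=; ring.
Qed.

Lemma family6_primitive a b : in_local a -> in_local b -> ~ in_max 2 -> ~ in_max 3 ->
  in_max (wdisc (family6 a b)) -> in_max (wc4 (family6 a b)) -> in_max a /\ in_max b.
Proof.
move=> al bl n2 n3 hD hC.
pose s := [:: (a, 2%N); (b, 6%N); (a + b, 3%N); (a + 9 * b, 1%N)].
have e : \prod_(x <- s) x.1 ^+ x.2 = wdisc (family6 a b).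
  by rewrite !big_cons big_nil /wdisc /wb2 /wb4 /wb6 /wb8 /=; ring.
have hR : in_max (\prod_(x <- s) x.1).
  apply: in_max_rad; last by rewrite /=; local_ring.
  by rewrite e.
rewrite !big_cons big_nil /= in hR.
split.
- apply: (@bezout_in_max _ _ (2 ^+ 4) _ 7
    (7029 * a ^+ 3 + (23 * 1000 + 118) * a ^+ 2 * b + 8829 * a * b ^+ 2
     + 7236 * b ^+ 3)
    (16 * a ^+ 3 - 7221 * a ^+ 2 * b - 7236 * a * b ^+ 2) _ _ _ _ _ _ _ hR hC); try local_ring.
  by rewrite /wc4 /wb2 /wb4 /=; ring.
(* The prime 3 enters only through the identity for [b]. *)
- apply: (@bezout_in_max _ _ (2 ^+ 4 * 3 ^+ 3) _ 7
    (-2 * a ^+ 3 - 27 * a ^+ 2 * b - 96 * a * b ^+ 2 - 87 * b ^+ 3)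
    (2 * a ^+ 2 * b + 23 * a * b ^+ 2 + 48 * b ^+ 3) _ _ _ _ _ _ _ hR hC); try local_ring.
  by rewrite /wc4 /wb2 /wb4 /=; ring.
Qed.

Lemma family7_primitive a b : in_local a -> in_local b -> ~ in_max 7 ->
  in_max (wdisc (family7 a b)) -> in_max (wc4 (family7 a b)) -> in_max a /\ in_max b.
Proof.
move=> al bl n7 hD hC.
pose s := [:: (a, 7%N); (b, 7%N); (a - b, 7%N);
  (a ^+ 3 + 5 * a ^+ 2 * b - 8 * a * b ^+ 2 + b ^+ 3, 1%N)].
have e : \prod_(x <- s) x.1 ^+ x.2 = - wdisc (family7 a b).
  by rewrite !big_cons big_nil /wdisc /wb2 /wb4 /wb6 /wb8 /=; ring.
have hR : in_max (\prod_(x <- s) x.1).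
  apply: in_max_rad; last by rewrite /=; local_ring.
  by rewrite e; apply: in_maxN.
rewrite !big_cons big_nil /= in hR.
split.
- apply: (@bezout_in_max _ _ (7 ^+ 2) _ 13
    (-779 * a ^+ 7 - (40 * 1000 + 789) * a ^+ 6 * b
     + (40 * 1000 + 880) * a ^+ 5 * b ^+ 2
     + (92 * 1000 + 162) * a ^+ 4 * b ^+ 3
     - (194 * 1000 + 229) * a ^+ 3 * b ^+ 4
     + (200 * 1000 + 200) * a ^+ 2 * b ^+ 5 - (66 * 1000 + 374) * a * b ^+ 6
     + 5883 * b ^+ 7)
    (49 * a ^+ 5 + 583 * a ^+ 4 * b + (42 * 1000 + 259) * a ^+ 3 * b ^+ 2
     - (48 * 1000 + 725) * a ^+ 2 * b ^+ 3 + 5883 * a * b ^+ 4) _ _ _ _ _ _ _ hR hC); try local_ring.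
  by rewrite /wc4 /wb2 /wb4 /=; ring.
- apply: (@bezout_in_max _ _ (7 ^+ 2) _ 13
    (-5883 * a ^+ 7 - (25 * 1000 + 193) * a ^+ 6 * b
     + (74 * 1000 + 501) * a ^+ 5 * b ^+ 2
     + (17 * 1000 + 66) * a ^+ 4 * b ^+ 3
     - (195 * 1000 + 671) * a ^+ 3 * b ^+ 4
     + (281 * 1000 + 925) * a ^+ 2 * b ^+ 5 - (184 * 1000 + 478) * a * b ^+ 6
     + (36 * 1000 + 954) * b ^+ 7)
    (5883 * a ^+ 4 * b + (25 * 1000 + 193) * a ^+ 3 * b ^+ 2
     - (68 * 1000 + 618) * a ^+ 2 * b ^+ 3 + (37 * 1000 + 542) * a * b ^+ 4
     + 49 * b ^+ 5) _ _ _ _ _ _ _ hR hC); try local_ring.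
  by rewrite /wc4 /wb2 /wb4 /=; ring.
Qed.

Lemma family8_primitive a b : in_local a -> in_local b -> ~ in_max 2 ->
  in_max (wdisc (family8 a b)) -> in_max (wc4 (family8 a b)) -> in_max a /\ in_max b.
Proof.
move=> al bl n2 hD hC.
pose s := [:: (a, 2%N); (b, 8%N); (a - 2 * b, 4%N); (a - b, 8%N);
  (a ^+ 2 - 8 * a * b + 8 * b ^+ 2, 1%N)].
have e : \prod_(x <- s) x.1 ^+ x.2 = wdisc (family8 a b).
  by rewrite !big_cons big_nil /wdisc /wb2 /wb4 /wb6 /wb8 /=; ring.
have hR : in_max (\prod_(x <- s) x.1).
  apply: in_max_rad; last by rewrite /=; local_ring.
  by rewrite e.
rewrite !big_cons big_nil /= in hR.
split.
- apply: (@bezout_in_max _ _ (1) _ 13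
    (-4004 * a ^+ 7 + (40 * 1000 + 40) * a ^+ 6 * b
     - (158 * 1000 + 496) * a ^+ 5 * b ^+ 2
     + (321 * 1000 + 584) * a ^+ 4 * b ^+ 3
     - (351 * 1000 + 600) * a ^+ 3 * b ^+ 4
     + (196 * 1000 + 80) * a ^+ 2 * b ^+ 5 - (55 * 1000 + 440) * a * b ^+ 6
     + (15 * 1000 + 840) * b ^+ 7)
    (a ^+ 5 + 4020 * a ^+ 4 * b - (19 * 1000 + 860) * a ^+ 3 * b ^+ 2
     + (31 * 1000 + 680) * a ^+ 2 * b ^+ 3 - (15 * 1000 + 840) * a * b ^+ 4) _ _ _ _ _ _ _ hR hC); try local_ring.
  by rewrite /wc4 /wb2 /wb4 /=; ring.
- apply: (@bezout_in_max _ _ (2 ^+ 4) _ 13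
    (-1209 * a ^+ 7 + (17 * 1000 + 925) * a ^+ 6 * b
     - (95 * 1000 + 25) * a ^+ 5 * b ^+ 2
     + (236 * 1000 + 655) * a ^+ 4 * b ^+ 3
     - (302 * 1000 + 530) * a ^+ 3 * b ^+ 4
     + (186 * 1000 + 500) * a ^+ 2 * b ^+ 5 - (51 * 1000 + 880) * a * b ^+ 6
     + (16 * 1000 + 480) * b ^+ 7)
    (1209 * a ^+ 4 * b - (11 * 1000 + 880) * a ^+ 3 * b ^+ 2
     + (27 * 1000 + 162) * a ^+ 2 * b ^+ 3 - (16 * 1000 + 476) * a * b ^+ 4
     + b ^+ 5) _ _ _ _ _ _ _ hR hC); try local_ring.
  by rewrite /wc4 /wb2 /wb4 /=; ring.
Qed.

Lemma family9_primitive a b : in_local a -> in_local b -> ~ in_max 3 ->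
  in_max (wdisc (family9 a b)) -> in_max (wc4 (family9 a b)) -> in_max a /\ in_max b.
Proof.
move=> al bl n3 hD hC.
pose s := [:: (a, 9%N); (b, 9%N); (a - b, 9%N); (a ^+ 2 - a * b + b ^+ 2, 3%N);
  (a ^+ 3 + 3 * a ^+ 2 * b - 6 * a * b ^+ 2 + b ^+ 3, 1%N)].
have e : \prod_(x <- s) x.1 ^+ x.2 = - wdisc (family9 a b).
  by rewrite !big_cons big_nil /wdisc /wb2 /wb4 /wb6 /wb8 /=; ring.
have hR : in_max (\prod_(x <- s) x.1).
  apply: in_max_rad; last by rewrite /=; local_ring.
  by rewrite e; apply: in_maxN.
rewrite !big_cons big_nil /= in hR.
split.
- apply: (@bezout_in_max _ _ (3 ^+ 3) _ 19
    (-(10 * 1000 + 602) * a ^+ 11 - (18 * 1000 + 335) * a ^+ 10 * b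
     + (128 * 1000 + 206) * a ^+ 9 * b ^+ 2
     - (175 * 1000 + 707) * a ^+ 8 * b ^+ 3
     - (23 * 1000 + 130) * a ^+ 7 * b ^+ 4
     + (447 * 1000 + 903) * a ^+ 6 * b ^+ 5
     - (872 * 1000 + 451) * a ^+ 5 * b ^+ 6
     + (1133 * 1000 + 628) * a ^+ 4 * b ^+ 7
     - (897 * 1000 + 222) * a ^+ 3 * b ^+ 8
     + (437 * 1000 + 751) * a ^+ 2 * b ^+ 9
     - (108 * 1000 + 659) * a * b ^+ 10 + 9694 * b ^+ 11)
    (27 * a ^+ 7 + (10 * 1000 + 602) * a ^+ 6 * b
     + (29 * 1000 + 261) * a ^+ 5 * b ^+ 2
     - (89 * 1000 + 423) * a ^+ 4 * b ^+ 3
     + (109 * 1000 + 749) * a ^+ 3 * b ^+ 4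
     - (69 * 1000 + 883) * a ^+ 2 * b ^+ 5 + 9694 * a * b ^+ 6) _ _ _ _ _ _ _ hR hC); try local_ring.
  by rewrite /wc4 /wb2 /wb4 /=; ring.
- apply: (@bezout_in_max _ _ (3 ^+ 3) _ 19
    (-9694 * a ^+ 11 - 2025 * a ^+ 10 * b
     + (115 * 1000 + 669) * a ^+ 9 * b ^+ 2
     - (247 * 1000 + 608) * a ^+ 8 * b ^+ 3
     + (125 * 1000 + 172) * a ^+ 7 * b ^+ 4
     + (372 * 1000 + 51) * a ^+ 6 * b ^+ 5
     - (1028 * 1000 + 139) * a ^+ 5 * b ^+ 6
     + (1538 * 1000 + 316) * a ^+ 4 * b ^+ 7
     - (1525 * 1000 + 845) * a ^+ 3 * b ^+ 8
     + (941 * 1000 + 93) * a ^+ 2 * b ^+ 9 - (340 * 1000 + 668) * a * b ^+ 10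
     + (51 * 1000 + 76) * b ^+ 11)
    (9694 * a ^+ 6 * b + (11 * 1000 + 719) * a ^+ 5 * b ^+ 2
     - (94 * 1000 + 256) * a ^+ 4 * b ^+ 3
     + (155 * 1000 + 377) * a ^+ 3 * b ^+ 4
     - (133 * 1000 + 934) * a ^+ 2 * b ^+ 5 + (51 * 1000 + 400) * a * b ^+ 6
     + 27 * b ^+ 7) _ _ _ _ _ _ _ hR hC); try local_ring.
  by rewrite /wc4 /wb2 /wb4 /=; ring.
Qed.

Lemma family2x4_primitive a b : in_local a -> in_local b -> ~ in_max 2 ->
  in_max (wdisc (family2x4 a b)) -> in_max (wc4 (family2x4 a b)) -> in_max a /\ in_max b.
Proof.
move=> al bl n2 hD hC.
pose s := [:: (a, 2%N); (b, 4%N); (a + 4 * b, 4%N); (a + 8 * b, 2%N)].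
have e : \prod_(x <- s) x.1 ^+ x.2 = wdisc (family2x4 a b).
  by rewrite !big_cons big_nil /wdisc /wb2 /wb4 /wb6 /wb8 /=; ring.
have hR : in_max (\prod_(x <- s) x.1).
  apply: in_max_rad; last by rewrite /=; local_ring.
  by rewrite e.
rewrite !big_cons big_nil /= in hR.
split.
- apply: (@bezout_in_max _ _ (1) _ 7
    (224 * a ^+ 3 + 2032 * a ^+ 2 * b + 2880 * a * b ^+ 2 + 7680 * b ^+ 3)
    (a ^+ 3 - 240 * a ^+ 2 * b - 960 * a * b ^+ 2) _ _ _ _ _ _ _ hR hC); try local_ring.
  by rewrite /wc4 /wb2 /wb4 /=; ring.
(* This is [c4 = a (a + 4 b)^2 (a + 8 b) + 2^8 b^4] multiplied by [b^3]. *)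
- apply: (@bezout_in_max _ _ (2 ^+ 8) _ 7
    (-a * b ^+ 2 - 4 * b ^+ 3)
    (b ^+ 3) _ _ _ _ _ _ _ hR hC); try local_ring.
  by rewrite /wc4 /wb2 /wb4 /=; ring.
Qed.

End PrimitiveFamilies.

(** * Additive reduction *)

Section AdditiveReduction.
Variables (K : fieldExtType rat) (p : prime_idealr (ringOfIntegers K)).
Hypothesis hp : nonzero_ideal p.
Local Notation in_local := (in_local p).
Local Notation in_max := (in_max p).

(** In a valuation ring no coprime numerator and denominator are sought: [t] or [t^-1] is local, and
    the other coordinate is 1. *)
Lemma primitive_coordinates (t : K) : t != 0 -> exists a b : K,
  [/\ a != 0, in_local a, in_local b, ~ (in_max a /\ in_max b) & t = b / a].
Proof.
move=> t0; have [tl|tl] := in_local_or_inv hp t.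
  exists 1, t; split; rewrite ?oner_eq0 ?divr1 //; first exact: in_local1.
  by case=> /in_max1.
exists t^-1, 1; split; rewrite ?invr_eq0 ?invrK ?mul1r //; first exact: in_local1.
by case=> _ /in_max1.
Qed.

Variable E : ellipticCurve K.
Hypothesis Eadd : additive_reduction_at p E.

(** [W] arises from a minimal model by some [u], and minimality makes [u^-12], hence [u^-1], local.
    The discriminant and [c4] only gain the factors [u^-12] and [u^-4]. *)
Lemma additive_integral_model W : model_of E W -> integral_at p W ->
  in_max (wdisc W) /\ in_max (wc4 W).
Proof.
move=> EW Wint; have [M [[EM Mint Mmin] /(valp_gt0 hp) dM /(valp_gt0 hp) cM]] := Eadd.
have dM0 := wdisc_model_of EM (ec_disc_neq0 E).
have /(valp_ge hp _ dM0) := Mmin W EW Wint.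
have [u [r [s [t [u0 ->]]]]] := model_of_trans (model_of_sym EM) EW.
rewrite wdisc_change_vars // wc4_change_vars // mulrAC divff // div1r => ul.
have {}ul : in_local u^-1 by apply: (in_local_root hp (n := 12)); rewrite ?exprVn.
by split; apply: in_maxMr => //; rewrite -[_^-1](exprVn u); apply: in_localX.
Qed.

Lemma additive_family (a1 a2 a3 : K) : model_of E (Weierstrass a1 a2 a3 0 0) ->
  in_local a1 -> in_local a2 -> in_local a3 ->
  in_max (wdisc (Weierstrass a1 a2 a3 0 0)) /\
  in_max (wc4 (Weierstrass a1 a2 a3 0 0)).
Proof.
move=> EW l1 l2 l3; have l0 : in_local 0 by apply/in_max_local/in_max0.
by apply: additive_integral_model => //; split; apply/valp_ge0.
Qed.

Variables (T : zmodType) (f : T -> option (K * K)) (g : T).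
Hypothesis fP : point_hom E f.

(** [b = 0] would make the discriminant vanish. The scale [v] stays free so that each family can
    clear its own denominators. *)
Lemma tate_model : g *+ 2 != 0 -> g *+ 3 != 0 ->
  exists b c (f' : T -> option (K * K)),
    [/\ b != 0, point_hom (tate b c) f', f' g = Some (0, 0)
      & forall v, v != 0 -> model_of E
          (Weierstrass (v * (1 - c)) (- (v ^+ 2 * b)) (- (v ^+ 3 * b)) 0 0)].
Proof.
move=> g2 g3; have g0 : g != 0 by apply: contraNneq g2 => ->; rewrite mul0rn.
have g3' : g + g + g != 0 by move: g3; rewrite mulrS mulr2n addrA.
have [b [c [f' [EW fP' fg]]]] := tate_normal_form fP g0 g2 g3'.
exists b, c, f'; split=> // [|v v0].
  apply: contraNneq (wdisc_model_of EW (ec_disc_neq0 E)) => ->.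
  by apply/eqP; rewrite /wdisc /wb2 /wb4 /wb6 /wb8 /=; ring.
apply: model_of_trans EW _; exists v^-1, 0, 0, 0; rewrite invr_eq0; split=> //.
by apply: weierstrass_eq => /=; field; rewrite ?oner_eq0 ?v0.
Qed.

(** Only multiples of [g] are constrained, not [T], so larger groups containing such a point are
    covered too. *)
Lemma additive_order5 : g *+ 2 != 0 -> g *+ 3 != 0 -> g *+ 5 = 0 -> in_max 5.
Proof.
move=> g2 g3 g5; have [b [c [f' [b0 fP' fg EW]]]] := tate_model g2 g3.
have cE := tate_order5 fP' fg b0 g5; subst c.
have [x [y [x0 xl yl xy bE]]] := primitive_coordinates b0.
have {}EW : model_of E (family5 x y).
  have := EW x x0; congr (model_of E _).
  by apply: weierstrass_eq => //=; rewrite bE; field.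
have [|||dm cm] := additive_family EW; try local_ring.
by apply: contrapT => n5; apply: xy; apply: family5_primitive dm cm.
Qed.

Lemma additive_order6 : g *+ 2 != 0 -> g *+ 3 != 0 -> g *+ 6 = 0 ->
  in_max 2 \/ in_max 3.
Proof.
move=> g2 g3 g6; have [b [c [f' [b0 fP' fg EW]]]] := tate_model g2 g3.
have bE := tate_order6 fP' fg b0 g6; subst b.
have c0 : c != 0 by apply: contraNneq b0 => ->; rewrite expr0n addr0.
have [x [y [x0 xl yl xy cE]]] := primitive_coordinates c0.
have {}EW : model_of E (family6 x y).
  have := EW x x0; congr (model_of E _).
  by apply: weierstrass_eq => //=; rewrite cE; field.
have [|||dm cm] := additive_family EW; try local_ring.
apply: contrapT => /not_orP[n2 n3]; apply: xy; exact: family6_primitive dm cm.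
Qed.

Lemma additive_order7 : g *+ 2 != 0 -> g *+ 3 != 0 -> g *+ 4 != 0 ->
  g *+ 7 = 0 -> in_max 7.
Proof.
move=> g2 g3 g4 g7; have [b [c [f' [b0 fP' fg EW]]]] := tate_model g2 g3.
have [d [cE bE]] := tate_order7 fP' fg b0 g2 g4 g7; subst b c.
have d0 : d != 0 by apply: contraNneq b0 => ->; rewrite mulr0.
have [x [y [x0 xl yl xy dE]]] := primitive_coordinates d0.
have {}EW : model_of E (family7 x y).
  have := EW (x ^+ 2) (expf_neq0 _ x0); congr (model_of E _).
  by apply: weierstrass_eq => //=; rewrite dE; field.
have [|||dm cm] := additive_family EW; try local_ring.
by apply: contrapT => n7; apply: xy; apply: family7_primitive dm cm.
Qed.

Lemma additive_order8 : g *+ 2 != 0 -> g *+ 3 != 0 -> g *+ 4 != 0 ->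
  g *+ 8 = 0 -> in_max 2.
Proof.
move=> g2 g3 g4 g8; have [b [c [f' [b0 fP' fg EW]]]] := tate_model g2 g3.
have [d [d0 [cE bE]]] := tate_order8 fP' fg b0 g2 g4 g8; subst b c.
have [x [y [x0 xl yl xy dE]]] := primitive_coordinates d0.
have y0 : y != 0 by apply: contraNneq d0 => y0; rewrite dE y0 mul0r.
(* Here [c] also has the denominator [d = y / x], so the scale is [x y] instead of a power of
   [x]. *)
have {}EW : model_of E (family8 x y).
  have := EW (x * y) (mulf_neq0 x0 y0); congr (model_of E _).
  by apply: weierstrass_eq => //=; rewrite dE; field; rewrite ?x0 ?y0.
have [|||dm cm] := additive_family EW; try local_ring.
by apply: contrapT => n2; apply: xy; apply: family8_primitive dm cm.
Qed.

Lemma additive_order9 : g *+ 2 != 0 -> g *+ 3 != 0 -> g *+ 4 != 0 ->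
  g *+ 5 != 0 -> g *+ 9 = 0 -> in_max 3.
Proof.
move=> g2 g3 g4 g5 g9; have [b [c [f' [b0 fP' fg EW]]]] := tate_model g2 g3.
have [e [cE bE]] := tate_order9 fP' fg b0 g2 g3 g4 g5 g9; subst b c.
have e0 : e != 0 by apply: contraNneq b0 => ->; rewrite expr0n /= !mul0r.
have [x [y [x0 xl yl xy eE]]] := primitive_coordinates e0.
have {}EW : model_of E (family9 x y).
  have := EW (x ^+ 3) (expf_neq0 _ x0); congr (model_of E _).
  by apply: weierstrass_eq => //=; rewrite eE; field.
have [|||dm cm] := additive_family EW; try local_ring.
by apply: contrapT => n3; apply: xy; apply: family9_primitive dm cm.
Qed.

(** Order 4 alone leaves [b] free with [c = 0]; the extra involution [h] forces [b = q (4 q + 1)],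
    and [q] is the parameter. *)
Lemma additive_order2x4 h : g *+ 2 != 0 -> g *+ 3 != 0 -> g *+ 4 = 0 ->
  h != 0 -> h + h = 0 -> h != g *+ 2 -> in_max 2.
Proof.
move=> g2 g3 g4 h0 h2 hg; have [b [c [f' [b0 fP' fg EW]]]] := tate_model g2 g3.
have cE := tate_order4 fP' fg b0 g4.
have [q bE] := tate_order2x4 fP' fg b0 cE h0 h2 hg; subst b c.
have q0 : q != 0 by apply: contraNneq b0 => ->; rewrite mul0r.
have [x [y [x0 xl yl xy qE]]] := primitive_coordinates q0.
have {}EW : model_of E (family2x4 x y).
  have := EW x x0; congr (model_of E _).
  by apply: weierstrass_eq => //=; rewrite ?qE; field.
have [|||dm cm] := additive_family EW; try local_ring.
by apply: contrapT => n2; apply: xy; apply: family2x4_primitive dm cm.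
Qed.

End AdditiveReduction.

(** * The residue characteristic for each group *)

Lemma embeds_point_hom (K : fieldType) (T : zmodType) (E : ellipticCurve K) :
  embeds T E -> exists f : T -> option (K * K), point_hom E f.
Proof.
move=> [f fI fD]; exists (fun g => point_val (f g)); split.
- exact: inj_comp val_inj fI.
- by move=> g; apply: point_valP.
- by move=> g h; rewrite fD.
Qed.

Lemma pchar_ideal_quot (K : fieldExtType rat)
    (p : prime_idealr (ringOfIntegers K)) (l : nat) :
  prime l -> in_max p l%:R -> l \in GRing.pchar {ideal_quot p}.
Proof.
rewrite -(rmorph_nat (@algint_val K)) inE => -> /in_max_val lp /=.
rewrite -(rmorph_nat (\pi_{ideal_quot p})%qT) -(rmorph0 (\pi_{ideal_quot p})%qT).
by rewrite -Quotient.idealrBE subr0.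
Qed.

Unset Implicit Arguments.
Set Strict Implicit.
Local Close Scope ring_scope.

Theorem theorem3p3 (K : fieldExtType rat) (E : ellipticCurve K)
    (T : zmodType) (S : seq nat) (hT : torsion_table T S)
    (hE : embeds T E)
    (p : prime_idealr (ringOfIntegers K)) (hp : nonzero_ideal p)
    (hadd : additive_reduction_at p E) :
  exists2 l : nat, l \in [pchar {ideal_quot p}]%R & l \in S.
Proof.
have witness (l : nat) : prime l -> in_max p (l%:R)%R -> l \in S ->
    exists2 l : nat, l \in [pchar {ideal_quot p}]%R & l \in S.
  by move=> l_pr /(pchar_ideal_quot l_pr) lp lS; exists l.
have [f fP] := embeds_point_hom hE.
case: hT f fP witness => f fP witness {hE}.
- by apply: (witness 5) => //; apply: (additive_order5 hp hadd (g := 1%R) fP) => //;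
    exact/eqP.
- have [|||m|m] := additive_order6 hp hadd (g := 1%R) fP => //; first exact/eqP.
    exact: (witness 2).
  exact: (witness 3).
- by apply: (witness 7) => //; apply: (additive_order7 hp hadd (g := 1%R) fP) => //;
    exact/eqP.
- by apply: (witness 2) => //; apply: (additive_order8 hp hadd (g := 1%R) fP) => //;
    exact/eqP.
- by apply: (witness 3) => //; apply: (additive_order9 hp hadd (g := 1%R) fP) => //;
    exact/eqP.
(* Twice a generator has order 5 in ['Z_10], and order 6 in ['Z_12], treated next. *)
- by apply: (witness 5) => //; apply: (additive_order5 hp hadd (g := 2%:R%R) fP) => //;
    exact/eqP.
- have [|||m|m] := additive_order6 hp hadd (g := 2%:R%R) fP => //; first exact/eqP.
    exact: (witness 2).
  exact: (witness 3).
(* [(1, 0)] has order 2 and differs from [(0, 2)], twice the point of order 4. *)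
- by apply: (witness 2) => //; apply: (additive_order2x4 hp hadd (g := (0, 1)%R) (h := (1, 0)%R) fP) => //;
    exact/eqP.
(* For the last two groups a generator of the second factor suffices. *)
- have [|||m|m] := additive_order6 hp hadd (g := (0, 1)%R) fP => //; first exact/eqP.
    exact: (witness 2).
  exact: (witness 3).
- by apply: (witness 2) => //; apply: (additive_order8 hp hadd (g := (0, 1)%R) fP) => //;
    exact/eqP.
Qed.
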